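(* Let $n>1$ and $\lambda>0$. Then: (1) the $n$-tuple of operators $(M_{s_1},\dots,M_{s_n})$ on $\mathbb{A}^{(\lambda)}_{\rm sym}(\mathbb{D}^n)$ is unitarily equivalent to the $n$-tuple of operators $(\Lambda^{(\rm sym)}_1,\dots,\Lambda^{(\rm sym)}_n)$ on $\ell^2(\mathcal{P}^{(\rm sym)}_n)$, where $\Lambda^{(\rm sym)}_k$ is the weighted shift on the generalized directed semi-tree $(G^{(k)}_{\rm sym},r_k)$ given by $$\Lambda^{(\rm sym)}_k\chi_{\mathbf u}=\sum_{\mathbf v\in(\mathcal{I}^{(k)}_{\mathbf u}/\sim)\cap\mathcal{P}^{(\rm sym)}_n}c^{(k)}_{\mathbf u,\mathbf v}\,\frac{\|m_{\mathbf v}\|}{\|m_{\mathbf u}\|}\,\chi_{\mathbf v},\qquad\mathbf u\in\mathcal{P}^{(\rm sym)}_n;$$ (2) the $n$-tuple of operators $(M_{s_1},\dots,M_{s_n})$ on $\mathbb{A}^{(\lambda)}_{\rm anti}(\mathbb{D}^n)$ is unitarily equivalent to the $n$-tuple of operators $(\Lambda^{(\rm anti)}_1,\dots,\Lambda^{(\rm anti)}_n)$ on $\ell^2(\mathcal{P}^{(\rm anti)}_n)$, where $\Lambda^{(\rm anti)}_k$ is the weighted shift on the generalized directed semi-tree $(G^{(k)}_{\rm anti},m_k)$ given by $$\Lambda^{(\rm anti)}_k\chi_{\mathbf u}=\sum_{\mathbf v\in\mathcal{I}^{(k)}_{\mathbf u}\cap\mathcal{P}^{(\rm anti)}_n}\frac{\|a_{\mathbf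 v}\|}{\|a_{\mathbf u}\|}\,\chi_{\mathbf v},\qquad\mathbf u\in\mathcal{P}^{(\rm anti)}_n.$$
   Context: $\mathbb{D}$ is the open unit disc. $\mathbb{A}^{(\lambda)}(\mathbb{D}^n)$ is the Hilbert space of holomorphic functions on $\mathbb{D}^n$ with reproducing kernel $K^{(\lambda)}(\mathbf z,\mathbf w)=\prod_{j=1}^n(1-z_j\overline{w_j})^{-\lambda}$. With $\mathfrak{S}_n$ the permutation group acting by permuting coordinates, $\mathbb{A}^{(\lambda)}_{\rm sym}(\mathbb{D}^n)=\{f\in\mathbb{A}^{(\lambda)}(\mathbb{D}^n):f\circ\sigma^{-1}=f\ \forall\sigma\in\mathfrak{S}_n\}$ and $\mathbb{A}^{(\lambda)}_{\rm anti}(\mathbb{D}^n)=\{f\in\mathbb{A}^{(\lambda)}(\mathbb{D}^n):f\circ\sigma^{-1}=\mathrm{sgn}(\sigma)f\ \forall\sigma\in\mathfrak{S}_n\}$. $s_k$ is the elementary symmetric polynomial of degree $k$ in $n$ variables and $M_{s_k}$ is multiplication by $s_k$, restricted to the respective (reducing) subspace. $\mathcal{Q}_n$ is the set of $\mathbf u\in\mathbb{N}_0^n$ with $u_1\ge\cdots\ge u_n\ge0$. $\mathcal{P}^{(\rm anti)}_n=\{\mathbf v+\boldsymbol\delta:\mathbf v\in\mathcal{Q}_n\}$, $\boldsymbol\delta=(n-1,n-2,\dots,1,0)$. On $\mathbb{N}_0^n$, $\mathbf u\sim\mathbf v$ if they differ by a permutation of coordinates; $\mathcal{P}^{(\rm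 sym)}_n=\{[\mathbf u]:\mathbf u\in\mathcal{Q}_n\}$ with $[\mathbf u]=\{\mathbf v\in\mathcal{Q}_n:\mathbf v\sim\mathbf u\}$ (each class is a singleton, so $\mathcal{P}^{(\rm sym)}_n$ is identified with $\mathcal{Q}_n$). For $\mathbf u\in\mathcal{Q}_n$, $\mathcal{I}^{(k)}_{\mathbf u}=\{\mathbf v\in\mathcal{Q}_n:\sum_j(v_j-u_j)=k,\ 0\le v_j-u_j\le1\ \forall j\}$. For $\mathbf u\in\mathcal{P}^{(\rm anti)}_n$, $a_{\mathbf u}(\mathbf z)=\det\big((z_j^{u_i})\big)_{i,j=1}^n$, with norm in $\mathbb{A}^{(\lambda)}(\mathbb{D}^n)$ equal to $\|a_{\mathbf u}\|=\sqrt{\mathbf u!\,n!/(\lambda)_{\mathbf u}}$, where $\mathbf u!=\prod_ju_j!$, $(\lambda)_{\mathbf u}=\prod_j(\lambda)_{u_j}$ and $(\lambda)_{r}=\lambda(\lambda+1)\cdots(\lambda+r-1)$. For $\mathbf u\in\mathcal{P}^{(\rm sym)}_n$, $m_{\mathbf u}(\mathbf z)=\sum_{\boldsymbol\beta\in\mathfrak{S}_n\mathbf u}\mathbf z^{\boldsymbol\beta}$ is the monomial symmetric polynomial (sum over distinct permutations of $\mathbf u$), with norm $\|m_{\mathbf u}\|=\sqrt{\mathbf u!\,n!/((\lambda)_{\mathbf u}\boldsymbol\alpha!)}$, where $\boldsymbol\alpha=(\alpha_1,\alpha_2,\dots)$ lists the multiplicities of the distinct components of $\mathbf u$ and $\boldsymbol\alpha!=\prod_i\alpha_i!$.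 The coefficients $c^{(k)}_{\mathbf u,\mathbf v}>0$ are the rational numbers determined by $s_km_{\mathbf u}=\sum_{\mathbf v\in(\mathcal{I}^{(k)}_{\mathbf u}/\sim)\cap\mathcal{P}^{(\rm sym)}_n}c^{(k)}_{\mathbf u,\mathbf v}m_{\mathbf v}$. $G^{(k)}_{\rm sym}$ is the directed graph with vertex set $\mathcal{P}^{(\rm sym)}_n$ and edges $(\mathbf u,\mathbf v)$ with $\mathbf v\in(\mathcal{I}^{(k)}_{\mathbf u}/\sim)\cap\mathcal{P}^{(\rm sym)}_n$; $G^{(k)}_{\rm anti}$ is the directed graph with vertex set $\mathcal{P}^{(\rm anti)}_n$ and edges $(\mathbf u,\mathbf v)$ with $\mathbf v\in\mathcal{I}^{(k)}_{\mathbf u}\cap\mathcal{P}^{(\rm anti)}_n$; $r_k$ and $m_k$ are the least non-negative integers bounding $\mathrm{card}(\mathrm{Chi}(\mathbf u)\cap\mathrm{Chi}(\mathbf v))$ over distinct vertices $\mathbf u,\mathbf v$ in the respective graph, where $\mathrm{Chi}(\mathbf u)=\{\mathbf v:(\mathbf u,\mathbf v)\text{ is an edge}\}$. A generalized directed semi-tree is a directed graph without circuits (directed cycles of distinct vertices of length at least 2), with at most countably many connected components, and with $\mathrm{card}(\mathrm{Chi}(u)\cap\mathrm{Chi}(v))$ uniformly bounded over distinct $u,v$. The weighted shift on a graph $(V,E)$ with weights $\lambda_{(u,v)}$, $(u,v)\in E$, acts on $\ell^2(V)$ by $\chi_u\mapsto\sum_{v\in\mathrm{Chi}(u)}\lambda_{(u,v)}\chi_v$,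 where $\chi_u$ is the indicator function of $\{u\}$. Two $n$-tuples $(A_i)$, $(B_i)$ of operators on Hilbert spaces $H_1$, $H_2$ are unitarily equivalent if a single unitary $U:H_1\to H_2$ satisfies $UA_i=B_iU$ for all $i$. *)

(* Defs.v *)
From HB Require Import structures.
From mathcomp Require Import all_boot all_order fingroup perm all_algebra.
From mathcomp Require Import all_classical all_reals all_analysis.
From mathcomp Require Import complex.
From mathcomp Require summability.

Set Implicit Arguments.
Unset Strict Implicit.
Unset Printing Implicit Defensive.

Import Order.TTheory GRing.Theory Num.Theory.
Import numFieldNormedType.Exports.

Local Open Scope classical_set_scope.
Local Open Scope complex_scope.
Local Open Scope ring_scope.

(* Only the values of [inner] on [carrier] are meaningful. *)
Record fspace (R : realType) (X : Type) := FSpace {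
  carrier :> (X -> R[i]) -> Prop;
  inner : (X -> R[i]) -> (X -> R[i]) -> R[i] }.

Definition hnorm (R : realType) (X : Type) (H : fspace R X) (f : X -> R[i]) : R :=
  Num.sqrt (complex.Re (inner H f f)).

(* [inner] is linear in the first variable; [0 <= inner H f f] in [R[i]] also
   says that [inner H f f] is real. *)
Definition is_hilbert (R : realType) (X : Type) (H : fspace R X) : Prop :=
  [/\ H (fun=> 0)
   /\ (forall (a : R[i]) f g, H f -> H g -> H (fun x => a * f x + g x)),
      forall (a : R[i]) f g h, H f -> H g -> H h ->
        inner H (fun x => a * f x + g x) h = a * inner H f h + inner H g h,
      forall f g, H f -> H g -> inner H g f = (inner H f g)^*,
      forall f, H f -> 0 <= inner H f f /\ (inner H f f = 0 -> f = fun=> 0)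
    & forall u : nat -> X -> R[i], (forall m, H (u m)) ->
        (forall e : R, 0 < e -> exists N, forall m p, (N <= m)%N -> (N <= p)%N ->
           hnorm H (fun x => u m x - u p x) < e) ->
        exists2 f, H f &
          (fun m => hnorm H (fun x => u m x - f x)) @ \oo --> (0 : R)].

Definition is_rkhs (R : realType) (X : Type) (H : fspace R X)
    (K : X -> X -> R[i]) : Prop :=
  is_hilbert H /\
  forall w, H (K ^~ w) /\ forall f, H f -> inner H f (K ^~ w) = f w.

(* [T f] is irrelevant for [f] outside [H]. *)
Definition bounded_operator (R : realType) (X : Type) (H : fspace R X)
    (T : (X -> R[i]) -> (X -> R[i])) : Prop :=
  [/\ forall f, H f -> H (T f),
      forall (a : R[i]) f g, H f -> H g ->
        T (fun x => a * f x + g x) = (fun x => a * T f x + T g x)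
    & exists M : R, forall f, H f -> hnorm H (T f) <= M * hnorm H f].

Definition unitary (R : realType) (X Y : Type) (H : fspace R X)
    (H' : fspace R Y) (U : (X -> R[i]) -> (Y -> R[i])) : Prop :=
  [/\ forall f, H f -> H' (U f),
      forall (a : R[i]) f g, H f -> H g ->
        U (fun x => a * f x + g x) = (fun y => a * U f y + U g y),
      forall f g, H f -> H g -> inner H' (U f) (U g) = inner H f g
    & forall g, H' g -> exists2 f, H f & U f = g].

Definition unitarily_equivalent (R : realType) (X Y : Type) (n : nat)
    (H : fspace R X) (H' : fspace R Y)
    (A : 'I_n -> (X -> R[i]) -> (X -> R[i]))
    (B : 'I_n -> (Y -> R[i]) -> (Y -> R[i])) : Prop :=
  [/\ forall k, bounded_operator H (A k),
      forall k, bounded_operator H' (B k)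
    & exists2 U, unitary H H' U & forall k f, H f -> U (A k f) = B k (U f)].

(* The inner product is the unconditional sum, i.e. the limit of the partial
   sums along the directed set of finite subsets of [V]. *)
Definition ell2 (R : realType) (V : choiceType) : fspace R V :=
  FSpace [set f : V -> R[i] |
            (\esum_(v in [set: V]) (((complex.Re `|f v|) ^+ 2)%:E : \bar R) < +oo)%E]
         (fun f g => summability.sum (fun v => (f v * (g v)^* : R[i]^o))).

Section graph.
Variables (V : choiceType) (E : V -> V -> Prop).

Definition Chi (u : V) : set V := [set v | E u v].

Definition no_circuit : Prop :=
  forall p : seq V, (2 <= size p)%N -> uniq p ->
    ~ path.cycle (fun u v => `[< E u v >]) p.

Definition connected_vertices (u v : V) : Prop :=
  exists2 p : seq V,
    path (fun x y => `[< E x y \/ E y x >]) u p & last u p = v.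

Definition components : set (set V) :=
  [set C | exists u, C = [set v | connected_vertices u v]].

Definition common_children_bound (m : nat) : Prop :=
  forall u v : V, u <> v -> ((Chi u `&` Chi v) #<= `I_m)%card.

Definition least_common_children_bound (m : nat) : Prop :=
  common_children_bound m /\
  forall m', common_children_bound m' -> (m <= m')%N.

Definition generalized_directed_semi_tree : Prop :=
  [/\ no_circuit, countable components & exists m, common_children_bound m].

(* Being bounded, [T] is determined by its values on the [\1_[set u]]. *)
Definition is_weighted_shift (R : realType) (w : V -> V -> R[i])
    (T : (V -> R[i]) -> (V -> R[i])) : Prop :=
  bounded_operator (ell2 R V) T /\
  forall u : V,
    T \1_[set u] = fun x => \sum_(v \in Chi u) w u v * \1_[set v] x.
End graph.

Section polydisc.
Variables (R : realType) (n : nat).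

Definition polydisc : set 'rV[R[i]]_n := [set z | forall j, `|z 0 j| < 1].

(* Complex Frechet differentiability of an arbitrary extension of [f]; [polydisc]
   being open, the extension does not matter. *)
Definition holomorphic (f : polydisc -> R[i]) : Prop :=
  exists2 F : 'rV[R[i]^o]_n -> R[i]^o,
    (forall z : 'rV[R[i]^o]_n, polydisc z -> differentiable F z) &
    (forall z : polydisc, f z = F (val z)).

(* Principal branch on the half-plane [0 < Re w], where [arg w] is
   [atan (Im w / Re w)]; this half-plane contains all [1 - z_j * (w_j)^*]. *)
Definition cln (w : R[i]) : R[i] :=
  ln (complex.Re `|w|) +i* atan (complex.Im w / complex.Re w).

Definition cexp (w : R[i]) : R[i] :=
  (expR (complex.Re w))%:C * (cos (complex.Im w) +i* sin (complex.Im w)).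

Definition cpow (w : R[i]) (s : R) : R[i] := cexp (s%:C * cln w).

Definition bergman_kernel (lambda : R) (z w : polydisc) : R[i] :=
  \prod_(j < n) cpow (1 - (val z) 0 j * ((val w) 0 j)^*) (- lambda).

Definition is_weighted_bergman (lambda : R) (A : fspace R polydisc) : Prop :=
  is_rkhs A (bergman_kernel lambda) /\ forall f, A f -> holomorphic f.

Lemma polydisc_perm (s : 'S_n) (z : polydisc) : col_perm s (val z) \in polydisc.
Proof. by apply/mem_set => j; rewrite mxE; apply: (set_mem (valP z)). Qed.

Definition perm_pt (s : 'S_n) (z : polydisc) : polydisc :=
  exist _ (col_perm s (val z)) (polydisc_perm s z).

Definition sym_part (A : fspace R polydisc) : fspace R polydisc :=
  FSpace [set f | A f /\ forall (s : 'S_n) z, f (perm_pt s^-1%g z) = f z]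
         (inner A).

Definition anti_part (A : fspace R polydisc) : fspace R polydisc :=
  FSpace [set f | A f /\
            forall (s : 'S_n) z, f (perm_pt s^-1%g z) = (-1) ^+ s * f z]
         (inner A).

Definition elem_sym (k : nat) (z : 'rV[R[i]]_n) : R[i] :=
  \sum_(S : {set 'I_n} | #|S| == k) \prod_(j in S) z 0 j.

Definition monomial_sym (u : n.-tuple nat) (z : 'rV[R[i]]_n) : R[i] :=
  \sum_(b <- permutations u) \prod_(j < n) z 0 j ^+ nth 0 b j.

Definition alternant (u : n.-tuple nat) (z : 'rV[R[i]]_n) : R[i] :=
  \det (\matrix_(i < n, j < n) z 0 j ^+ tnth u i).

(* Index [k : 'I_n] stands for degree [k.+1], as in all the tuples below. *)
Definition mul_elem_sym (k : 'I_n) (f : polydisc -> R[i]) : polydisc -> R[i] :=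
  fun z => elem_sym k.+1 (val z) * f z.

Definition norm_on (A : fspace R polydisc) (F : 'rV[R[i]]_n -> R[i]) : R :=
  hnorm A (fun z : polydisc => F (val z)).
End polydisc.
Arguments polydisc : clear implicits.

Section partitions.
Variable n : nat.

Definition Qn : set (n.-tuple nat) := [set u | sorted geq u].

Definition Panti : set (n.-tuple nat) :=
  [set u | exists2 v, Qn v & u = [tuple (tnth v j + (n.-1 - j))%N | j < n]].

(* Classes of the permutation relation on [Qn] are singletons. *)
Definition Psym : set (n.-tuple nat) := Qn.

Definition Iset (k : nat) (u : n.-tuple nat) : set (n.-tuple nat) :=
  [set v | [/\ Qn v,
      \sum_(j < n) ((tnth v j)%:Z - (tnth u j)%:Z) = k%:Z
    & forall j : 'I_n, 0 <= (tnth v j)%:Z - (tnth u j)%:Z <= 1]].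

Definition Gsym (k : 'I_n) (u v : Psym) : Prop := Iset k.+1 (val u) (val v).

Definition Ganti (k : 'I_n) (u v : Panti) : Prop := Iset k.+1 (val u) (val v).
End partitions.
Arguments Qn : clear implicits.
Arguments Panti : clear implicits.
Arguments Psym : clear implicits.
Arguments Gsym {n}.
Arguments Ganti {n}.

Definition is_sym_coeff (R : realType) (n : nat)
    (c : 'I_n -> Psym n -> Psym n -> rat) : Prop :=
  (forall k u v, Gsym k u v -> 0 < c k u v) /\
  forall (k : 'I_n) (u : Psym n) (z : 'rV[R[i]]_n),
    elem_sym k.+1 z * monomial_sym (val u) z =
    \sum_(v \in Chi (Gsym k) u) ratr (c k u v) * monomial_sym (val v) z.

Definition sym_weight (R : realType) (n : nat) (A : fspace R (polydisc R n))
    (c : 'I_n -> Psym n -> Psym n -> rat) (k : 'I_n) (u v : Psym n) : R[i] :=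
  (ratr (c k u v) * (norm_on A (monomial_sym (val v)) / norm_on A (monomial_sym (val u))))%:C.

Definition anti_weight (R : realType) (n : nat) (A : fspace R (polydisc R n))
    (u v : Panti n) : R[i] :=
  (norm_on A (alternant (val v)) / norm_on A (alternant (val u)))%:C.

(* Main.v *)
Require Import Defs.
From mathcomp Require Import all_boot all_order fingroup perm all_algebra.
From mathcomp Require Import finmap.
From mathcomp Require Import all_classical all_reals all_analysis.
From mathcomp Require Import complex ring lra zify.
From mathcomp Require summability.
Set Implicit Arguments.
Unset Strict Implicit.
Unset Printing Implicit Defensive.
Import Order.TTheory GRing.Theory Num.Theory.
Import numFieldNormedType.Exports.
Local Open Scope classical_set_scope.
Local Open Scope complex_scope.
Local Open Scope ring_scope.

(** Write [c_k = (l)_k / k!], so that [(1 - x)^(-l)] is the sum of the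
    [c_k x^k]. Everything rests on knowing that the monomials form an orthogonal
    basis of the space with kernel [prod_j (1 - z_j conj w_j)^(-l)], with
    [|z^u|^2 = 1 / prod_j c_(u_j)]. Once this is known, multiplication by a
    coordinate shifts the normalized basis with bounded weights, so the elementary
    symmetric polynomials are bounded multipliers; summing the monomials over the
    symmetric group, with or without signs, gives orthogonal bases of the two
    isotypic parts; Pieri's rule computes [s_k] on these bases; and transporting
    the multiplication operators by the unitary that sends the normalized basis to
    the canonical basis of [l^2] produces the weighted shifts.

    The kernel is given by the principal branch of the power, so its expansion has
    to be proved: along the segment [t x] the series and [(1 - t x)^l] have a
    constant product because both solve a linear differential equation
    ([cpow_series]).

    The space is only given through its reproducing property, and membership of
    the monomials is obtained by averaging. A combination of kernels at the points
    of a product grid of roots of unity, with a character of the grid as weights,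
    retains the terms of the expansion whose exponents lie in one residue class.
    For grids with [2^(i+1)] points per circle the inner products of these
    combinations depend only on the finer of two grids
    ([filtered_kernel_gram]); so they form a Cauchy sequence, and its limit is a
    nonzero multiple of one monomial ([monomial_in], [inner_monomial]).
    Completeness follows because the truncated expansions of a kernel converge to
    it in norm ([kernel_truncation_hlim]).

    Both parts of the theorem are instances of one statement about a character
    [eps] of the symmetric group ([isotypic_model]). Pieri's rule comes from
    multiplying [sum_s eps(s) z^(s u)] by [s_k]: the sum over the [k]-subsets [S]
    of the exponents [u + 1_S] appears at once ([elem_sym_symmetrized]), since
    [s_k] is symmetric. In the symmetric case terms are then collected by their
    decreasing rearrangement; in the antisymmetric case a repeated exponent gives
    zero and the others are all different. The graph statements only use that an
    edge adds the indicator function of a nonempty set of positions. *)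

(** * The coefficients of the binomial series *)

(** [nbc l k] is [(l)_k / k!], the coefficient of [x^k] in [(1 - x)^(-l)]. *)
Definition nbc (R : realType) (lambda : R) (k : nat) : R :=
  \prod_(i < k) ((lambda + i%:R) / i.+1%:R).

Section negative_binomial.
Variable R : realType.
Implicit Types (l q t : R) (x y : R[i]).

Lemma nbc0 l : nbc l 0 = 1.
Proof. by rewrite /nbc big_ord0. Qed.

Lemma nbcS l k : nbc l k.+1 = nbc l k * ((l + k%:R) / k.+1%:R).
Proof. by rewrite /nbc big_ord_recr. Qed.

Lemma nbc_gt0 l k : 0 < l -> 0 < nbc l k.
Proof.
by move=> l0; apply: prodr_gt0 => i _; rewrite divr_gt0// ltr_wpDr.
Qed.

(** The derivative of [(1 - x)^(-l)] is [l (1 - x)^(-(l + 1))], coefficientwise. *)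
Lemma nbc_diff l k : k.+1%:R * nbc l k.+1 = l * nbc (l + 1) k.
Proof.
elim: k => [|k IH]; first by rewrite nbcS !nbc0 addr0; field.
have k1 : (k%:R + 1 != 0 :> R) by rewrite natr1 pnatr_eq0.
have k2 : (k%:R + 1 + 1 != 0 :> R) by rewrite !natr1 pnatr_eq0.
rewrite nbcS; have -> : k.+2%:R * (nbc l k.+1 * ((l + k.+1%:R) / k.+2%:R)) =
    (k.+1%:R * nbc l k.+1) * ((l + k.+1%:R) / k.+1%:R).
  by rewrite -(natr1 k.+1) -(natr1 k); field; rewrite k1 k2.
by rewrite IH [in RHS]nbcS -(natr1 k); field.
Qed.

(** Multiplying [(1 - x)^(-(l + 1))] by [1 - x] gives [(1 - x)^(-l)],
    coefficientwise. *)
Lemma nbc_pascal l k : nbc (l + 1) k.+1 = nbc l k.+1 + nbc (l + 1) k.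
Proof.
have k0 : (k%:R + 1 != 0 :> R) by rewrite natr1 pnatr_eq0.
have := nbc_diff l k; rewrite -natr1 => /(congr1 (fun z => z / (k%:R + 1))).
rewrite mulrAC divff// mul1r => ->.
by rewrite nbcS -natr1; field.
Qed.

(** The ratio of consecutive terms, [q (l + k) / (k + 1)], is at most [1] from the
    rank [K] on, so the sum of the first terms is a bound. *)
Lemma nbc_exp_bounded l q : 0 < l -> 0 <= q < 1 ->
  exists C, forall k, nbc l k * q ^+ k <= C.
Proof.
move=> l0 /andP[q0 q1].
pose a k := nbc l k * q ^+ k.
have a0 k : 0 <= a k by rewrite mulr_ge0 ?exprn_ge0// ltW// nbc_gt0.
pose K := Num.truncn (q * l / (1 - q)).
have KP : q * l / (1 - q) < K.+1%:R by exact: truncnS_gt.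
have dec k : (K.+1 <= k)%N -> a k.+1 <= a k.
  move=> Kk; rewrite /a nbcS exprS.
  rewrite [leLHS](_ : _ = a k * (q * ((l + k%:R) / k.+1%:R))); last by rewrite /a; ring.
  rewrite ler_piMr// mulrA ler_pdivrMr// mul1r -natr1.
  have : q * l < k%:R * (1 - q).
    rewrite -ltr_pdivrMr ?subr_gt0//; apply: (lt_le_trans KP).
    by rewrite ler_nat.
  by nra.
exists (\sum_(i < K.+2) a i) => k.
have [kK|] := ltnP k K.+2.
  rewrite -/(a k) (bigD1 (Ordinal kK))//= lerDl; exact: sumr_ge0.
elim: k => // k IH; rewrite leq_eqVlt => /predU1P[<-|].
  apply: (le_trans (dec _ _)) => //.
  by rewrite big_ord_recr/= lerDr; apply: sumr_ge0 => i _.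
rewrite ltnS => Kk; apply: (le_trans (dec _ _)); last exact: IH.
exact: ltnW.
Qed.

Lemma is_cvg_nbc_series l q : 0 < l -> 0 <= q < 1 ->
  cvgn (series (fun k => nbc l k * q ^+ k)).
Proof.
move=> l0 /andP[q0 q1].
(* Any [p] strictly between [q] and [1] gives a geometric majorant. *)
pose p := (q + 1) / 2.
have p1 : p < 1 by rewrite /p; lra.
have qp : q < p by rewrite /p; lra.
have p0 : 0 < p by apply: le_lt_trans qp.
have qp0 : 0 <= q / p by apply: divr_ge0 => //; exact: ltW.
have [|C HC] := @nbc_exp_bounded l p l0; first by rewrite (ltW p0) p1.
apply: (@series_le_cvg _ _ (geometric C (q / p))) => [k|k|k|].
- by rewrite mulr_ge0 ?exprn_ge0// ltW// nbc_gt0.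
- rewrite /geometric/= mulr_ge0 ?exprn_ge0//.
  by apply: le_trans (HC 0%N); rewrite mulr_ge0// ltW// nbc_gt0.
- rewrite /geometric/= expr_div_n.
  have -> : nbc l k * q ^+ k = nbc l k * p ^+ k * (q ^+ k / p ^+ k).
    by field; rewrite gt_eqF// exprn_gt0.
  by rewrite ler_wpM2r// divr_ge0// exprn_ge0// ltW.
- apply: is_cvg_geometric_series.
  by rewrite ger0_norm// ltr_pdivrMr// mul1r.
Qed.

End negative_binomial.

(** * The binomial series at complex arguments *)

(** The norm of [R[i]] takes its values in [R[i]]; [nrm] is the same number as an
    element of [R]. *)
Local Notation nrm z := (complex.Re `|z|).

Section complex_norm.
Variable R : realType.
Implicit Types (z w : R[i]).

Lemma nrmE z : (nrm z)%:C = `|z|.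
Proof. by rewrite RRe_real// normr_real. Qed.

Lemma nrm_ge0 z : 0 <= nrm z.
Proof. by rewrite -ler0c nrmE. Qed.

Lemma nrmM z w : nrm (z * w) = nrm z * nrm w.
Proof. by apply: complexI; rewrite rmorphM/= !nrmE normrM. Qed.

Lemma nrmX z k : nrm (z ^+ k) = nrm z ^+ k.
Proof. by apply: complexI; rewrite rmorphXn/= !nrmE normrX. Qed.

Lemma nrmD z w : nrm (z + w) <= nrm z + nrm w.
Proof. by rewrite -lecR rmorphD/= !nrmE ler_normD. Qed.

Lemma nrm_sum (I : finType) (F : I -> R[i]) : nrm (\sum_i F i) <= \sum_i nrm (F i).
Proof.
elim: (index_enum I) => [|i s IH]; first by rewrite !big_nil normr0.
by rewrite !big_cons; apply: (le_trans (nrmD _ _)); rewrite lerD2l.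
Qed.

Lemma nrm_real (r : R) : nrm r%:C = `|r|.
Proof. by rewrite normc_def/= expr0n addr0 sqrtr_sqr. Qed.

Lemma Re_le_nrm z : `|complex.Re z| <= nrm z.
Proof. by rewrite -lecR nrmE normc_ge_Re. Qed.

Lemma Re_realM (a : R) z : complex.Re (a%:C * z) = a * complex.Re z.
Proof. by case: z => u v /=; rewrite mul0r subr0. Qed.

Lemma Im_realM (a : R) z : complex.Im (a%:C * z) = a * complex.Im z.
Proof. by case: z => u v /=; rewrite mul0r addr0. Qed.

Lemma nrmlt z (r : R) : (`|z| < r%:C) = (nrm z < r).
Proof. by rewrite -nrmE ltcR. Qed.

End complex_norm.

Section binomial_ode.
Variable R : realType.
Implicit Types (l t : R) (x y : R[i]).

(* [G l y x t] is the real part of [y] times the sum of the [c_k (t x)^k], as a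
   real power series in [t]. The factor [y] gives access to the imaginary part
   ([y = -i]) and makes the family stable under differentiation. *)
Let coef l y x k := nbc l k * complex.Re (y * x ^+ k).

Let G l y x t := limn (pseries (coef l y x) t).

Let cvgG l y x t : 0 < l -> nrm x * `|t| < 1 -> cvgn (pseries (coef l y x) t).
Proof.
move=> l0 xt1; apply: normed_cvg.
have q0 : 0 <= nrm x * `|t| by rewrite mulr_ge0// nrm_ge0.
apply: (@series_le_cvg _ _ (fun k => nrm y * (nbc l k * (nrm x * `|t|) ^+ k))) => [k|k|k|].
- exact: normr_ge0.
- apply: mulr_ge0; first exact: nrm_ge0.
  by rewrite mulr_ge0 ?exprn_ge0// ltW// nbc_gt0.
- rewrite /= /coef !normrM (ger0_norm (ltW (nbc_gt0 _ _)))// normrX exprMn mulrCA -mulrA.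
  apply: ler_wpM2l; first by rewrite ltW// nbc_gt0.
  rewrite mulrA ler_wpM2r ?exprn_ge0//.
  by rewrite -nrmX -nrmM Re_le_nrm.
- rewrite (_ : series _ = nrm y *: series (fun k => nbc l k * (nrm x * `|t|) ^+ k)); last first.
    by apply/funext => k; rewrite /series/= /GRing.scale/= -mulr_sumr.
  by apply: is_cvgZl_tmp; apply: is_cvg_nbc_series => //; rewrite q0.
Qed.

Let diffs_coef l y x : pseries_diffs (coef l y x) = coef (l + 1) (l%:C * x * y) x.
Proof.
apply/funext => k; rewrite /pseries_diffs /coef mulrA nbc_diff.
rewrite (_ : l%:C * x * y * x ^+ k = l%:C * (y * x ^+ k.+1)); last by rewrite exprS; ring.
by rewrite Re_realM; ring.
Qed.

Let is_derive_G l y x t : 0 < l -> nrm x < 1 -> `|t| <= 1 ->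
  is_derive t 1 (G l y x) (G (l + 1) (l%:C * x * y) x t).
Proof.
move=> l0 x1 t1; rewrite /G -diffs_coef.
have x0 := nrm_ge0 x.
(* A point beyond [1] at which the series still converges. *)
pose K := 2 / (1 + nrm x).
have K1 : 1 < K by rewrite /K ltr_pdivlMr; lra.
have K0 : 0 < K by exact: lt_trans K1.
have xK : nrm x * `|K| < 1.
  rewrite (gtr0_norm K0).
  by rewrite /K mulrA ltr_pdivrMr; lra.
apply: (@pseries_snd_diffs _ _ K).
- exact: cvgG.
- by rewrite diffs_coef; apply: cvgG => //; lra.
- by rewrite !diffs_coef; apply: cvgG => //; lra.
- by apply: le_lt_trans t1 _; rewrite gtr0_norm.
Qed.

Let GE l y x t : 0 < l -> nrm x * `|t| < 1 ->
  series (fun k => coef l y x k * t ^+ k) @ \oo --> G l y x t.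
Proof. by move=> l0 xt; apply: cvgG. Qed.

Let G_linear l y y' x t (a : R) : 0 < l -> nrm x * `|t| < 1 ->
  G l (a%:C * y + y') x t = a * G l y x t + G l y' x t.
Proof.
move=> l0 xt; apply/cvg_lim => //.
rewrite [X in X @ _](_ : _ = (fun k => a * series (fun k => coef l y x k * t ^+ k) k
   + series (fun k => coef l y' x k * t ^+ k) k)); last first.
  apply/funext => k; rewrite /pseries /series/= mulr_sumr -big_split/=.
  apply: eq_bigr => i _; rewrite /coef mulrDl raddfD/= -(mulrA a%:C) Re_realM; ring.
by apply: cvgD; [apply: cvgMr|]; exact: GE.
Qed.

(* [1 - t x] times the series of parameter [l + 1] is the one of parameter [l]. *)
Let G_pascal l y x t : 0 < l -> nrm x * `|t| < 1 ->
  G l y x t = G (l + 1) y x t - t * G (l + 1) (x * y) x t.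
Proof.
move=> l0 xt; apply/cvg_lim => //; rewrite -cvg_shiftS/=.
have l1 : 0 < l + 1 by lra.
rewrite [X in X @ _](_ : _ = (fun k => series (fun k => coef (l + 1) y x k * t ^+ k) k.+1
   - t * series (fun k => coef (l + 1) (x * y) x k * t ^+ k) k)); last first.
  apply/funext => k; rewrite /pseries /series/= mulr_sumr.
  rewrite [in LHS]big_nat_recl// [in RHS]big_nat_recl// -addrA; congr (_ + _).
    by rewrite /coef !nbc0.
  rewrite -sumrB; apply: eq_bigr => i _.
  rewrite /coef nbc_pascal (_ : x * y * x ^+ i = y * x ^+ i.+1); last by rewrite exprS; ring.
  by rewrite (exprS t); ring.
apply: cvgB; last by apply: cvgMl_tmp; exact: GE.
by rewrite (cvg_shiftS (series _)); exact: GE.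
Qed.

Let G0 l x t : 0 < l -> nrm x * `|t| < 1 -> G l 0 x t = 0.
Proof.
move=> l0 xt; have := G_linear 0 0 1 l0 xt.
by rewrite mulr0 addr0 mul1r => /esym/eqP; rewrite -subr_eq0 addrK => /eqP.
Qed.

Let G_complex l (p q : R) x t : 0 < l -> nrm x * `|t| < 1 ->
  G l (p +i* q) x t = p * G l 1 x t - q * G l (0 +i* (-1)) x t.
Proof.
move=> l0 xt.
rewrite (_ : p +i* q = p%:C * 1 + ((- q)%:C * (0 +i* (-1)) + 0)).
  by rewrite !G_linear// G0// addr0 mulNr.
by rewrite mulr1 addr0; apply/eqP; rewrite eq_complex/=; apply/andP; split; apply/eqP; ring.
Qed.

Let G_at0 l y x : G l y x 0 = complex.Re y.
Proof.
apply/cvg_lim => //; rewrite -cvg_shiftS/=.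
rewrite [X in X @ _](_ : _ = (fun=> complex.Re y)); first exact: cvg_cst.
apply/funext => k; rewrite /pseries /series/= big_nat_recl//= big1 => [|i _].
  by rewrite /coef nbc0 !expr0 mulr1 mul1r mulr1 addr0.
by rewrite expr0n/= mulr0.
Qed.

Lemma is_derive_0_segment (f : R -> R) :
  (forall t, `|t| <= 1 -> is_derive t 1 f 0) -> f 1 = f 0.
Proof.
move=> df.
have [||c _] := @MVT_segment _ f (fun=> 0) 0 1 ler01.
- move=> t; rewrite in_itv/= => /andP[t0 t1]; apply: df.
  by rewrite ger0_norm ltW.
- apply: derivable_within_continuous => t; rewrite in_itv/= => /andP[t0 t1].
  by apply: (@ex_derive _ _ _ _ _ _ _ (df t _)); rewrite ger0_norm.
by rewrite mul0r => /eqP; rewrite subr_eq0 => /eqP.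
Qed.

(** Along [t |-> t x], [p1 + i p2] is [(1 - t x)^l] and [g1 + i g2] is the sum of
    the series. Their logarithmic derivatives are opposite, so that the product
    keeps its value [1] at [t = 0]. *)
Section power_path.
Variables (a b l : R).
Let x := a +i* b.
Hypothesis x1 : nrm x < 1.
Hypothesis l0 : 0 < l.

Let d t := (1 - t * a) ^+ 2 + (t * b) ^+ 2.
Let A t := ln (d t) / 2.
Let B t := atan (- (t * b) / (1 - t * a)).
Let p1 t := expR (l * A t) * cos (l * B t).
Let p2 t := expR (l * A t) * sin (l * B t).

Let pos t : `|t| <= 1 -> 0 < 1 - t * a.
Proof.
move=> t1; rewrite subr_gt0; apply: (le_lt_trans (ler_norm _)).
rewrite normrM; apply: le_lt_trans x1.
by apply: (le_trans _ (Re_le_nrm x)); rewrite ler_piMl.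
Qed.

Let dpos t : `|t| <= 1 -> 0 < d t.
Proof. by move=> t1; rewrite ltr_pwDl ?sqr_ge0// exprn_gt0// pos. Qed.

(* Real and imaginary parts of the derivative of the logarithm of [1 - t x]. *)
Let u t := (t * b ^+ 2 - a * (1 - t * a)) / d t.
Let v t := - b / d t.

Let dA t : `|t| <= 1 -> is_derive t 1 A (u t).
Proof.
move=> t1.
have dd : is_derive t 1 d (2 * (t * b ^+ 2 - a * (1 - t * a))).
  apply: is_derive_eq; rewrite /GRing.scale/=; ring.
have dl := @is_derive1_comp _ (@ln R) d t _ _ (is_derive1_ln (dpos t1)) dd.
rewrite (_ : A = (fun t => 2^-1 *: (@ln R \o d) t)); last first.
  by apply/funext => s; rewrite /A/= mulrC.
apply: is_derive_eq; rewrite /GRing.scale/= /u; field.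
by rewrite gt_eqF// dpos.
Qed.

Let dB t : `|t| <= 1 -> is_derive t 1 B (v t).
Proof.
move=> t1; have t0 := pos t1.
have dq : is_derive t 1 (fun t => - (t * b) / (1 - t * a)) (- b / (1 - t * a) ^+ 2).
  have t0' : 1 - t * a != 0 by rewrite gt_eqF.
  have di : is_derive t 1 (fun t => 1 - t * a) (- a).
    by apply: is_derive_eq; rewrite /GRing.scale/=; ring.
  have dV := @is_deriveV _ (fun t => 1 - t * a) t _ 1 t0' di.
  by apply: is_derive_eq; rewrite /GRing.scale/=; field.
have dl := @is_derive1_comp _ (@atan R) (fun t => - (t * b) / (1 - t * a)) t _ _
  (is_derive1_atan _) dq.
apply: (is_derive_eq dl); rewrite /v /d; field.
have dt := dpos t1; rewrite /d in dt.
by rewrite gt_eqF//= gt_eqF//=.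
Qed.

Let dexp t : `|t| <= 1 ->
  is_derive t 1 (fun t => expR (l * A t)) (l * u t * expR (l * A t)).
Proof.
move=> t1; have dAt := dA t1.
have dl : is_derive t 1 (fun t => l *: A t) (l *: u t) by exact: is_deriveZ.
by apply: (is_derive_eq (@is_derive1_comp _ (@expR R) (fun t => l *: A t) t _ _ (is_derive_expR _) dl)); rewrite /GRing.scale/= mulrC.
Qed.

Let dp1 t : `|t| <= 1 -> is_derive t 1 p1 (l * (u t * p1 t - v t * p2 t)).
Proof.
move=> t1; have dBt := dB t1; have de := dexp t1.
have dl : is_derive t 1 (fun t => l *: B t) (l *: v t) by exact: is_deriveZ.
have dc := @is_derive1_comp _ (@cos R) (fun t => l *: B t) t _ _ (is_derive_cos _) dl.
by apply: (is_derive_eq (is_deriveM de dc)); rewrite /p1 /p2 /GRing.scale/=; ring.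
Qed.

Let dp2 t : `|t| <= 1 -> is_derive t 1 p2 (l * (u t * p2 t + v t * p1 t)).
Proof.
move=> t1; have dBt := dB t1; have de := dexp t1.
have dl : is_derive t 1 (fun t => l *: B t) (l *: v t) by exact: is_deriveZ.
have dc := @is_derive1_comp _ (@sin R) (fun t => l *: B t) t _ _ (is_derive_sin _) dl.
by apply: (is_derive_eq (is_deriveM de dc)); rewrite /p1 /p2 /GRing.scale/=; ring.
Qed.

Let g1 t := G l 1 x t.
Let g2 t := G l (0 +i* (-1)) x t.
(* The series of parameter [l + 1], in terms of which both the series of
   parameter [l] and its derivative are expressed. *)
Let h1 t := G (l + 1) 1 x t.
Let h2 t := G (l + 1) (0 +i* (-1)) x t.

Let l1 : 0 < l + 1. Proof. by rewrite addr_gt0. Qed.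

Let xt t : `|t| <= 1 -> nrm x * `|t| < 1.
Proof. by move=> t1; apply: le_lt_trans x1; rewrite ler_piMr// nrm_ge0. Qed.

Let g1E t : `|t| <= 1 -> g1 t = h1 t - t * (a * h1 t - b * h2 t).
Proof.
move=> /xt t1; rewrite /g1 (G_pascal _ l0 t1) mulr1.
by rewrite (G_complex a b l1 t1).
Qed.

Let g2E t : `|t| <= 1 -> g2 t = h2 t - t * (b * h1 t + a * h2 t).
Proof.
move=> /xt t1; rewrite /g2 (G_pascal _ l0 t1).
rewrite (_ : x * (0 +i* (-1)) = b +i* (- a)).
  by rewrite (G_complex _ _ l1 t1) mulNr opprK.
by apply/eqP; rewrite eq_complex/=; apply/andP; split; apply/eqP; ring.
Qed.

Let dg1 t : `|t| <= 1 -> is_derive t 1 g1 (l * (a * h1 t - b * h2 t)).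
Proof.
move=> t1; apply: (is_derive_eq (is_derive_G _ l0 x1 t1)).
rewrite (_ : l%:C * x * 1 = (l * a) +i* (l * b)).
  by rewrite (G_complex _ _ l1 (xt t1)) /h1 /h2; ring.
by apply/eqP; rewrite eq_complex/=; apply/andP; split; apply/eqP; ring.
Qed.

Let dg2 t : `|t| <= 1 -> is_derive t 1 g2 (l * (b * h1 t + a * h2 t)).
Proof.
move=> t1; apply: (is_derive_eq (is_derive_G _ l0 x1 t1)).
rewrite (_ : l%:C * x * (0 +i* (-1)) = (l * b) +i* (- (l * a))).
  by rewrite (G_complex _ _ l1 (xt t1)) /h1 /h2; ring.
by apply/eqP; rewrite eq_complex/=; apply/andP; split; apply/eqP; ring.
Qed.

Let At0 : A 0 = 0.
Proof. by rewrite /A /d !mul0r subr0 expr1n expr0n addr0 ln1 mul0r. Qed.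

Let Bt0 : B 0 = 0.
Proof. by rewrite /B !mul0r oppr0 mul0r atan0. Qed.

Let conserved_re : p1 1 * g1 1 - p2 1 * g2 1 = 1.
Proof.
transitivity (p1 0 * g1 0 - p2 0 * g2 0); last first.
  rewrite /p1 /p2 /g1 /g2 At0 Bt0 !mulr0 expR0 cos0 sin0 !G_at0/=; ring.
apply: (@is_derive_0_segment (fun t => p1 t * g1 t - p2 t * g2 t)) => t t1.
apply: (is_derive_eq (is_deriveB (is_deriveM (dp1 t1) (dg1 t1)) (is_deriveM (dp2 t1) (dg2 t1)))); rewrite /GRing.scale/= !(g1E t1) !(g2E t1) /u /v.
by have := dpos t1; rewrite /d => dt; field; rewrite gt_eqF.
Qed.

Let conserved_im : p1 1 * g2 1 + p2 1 * g1 1 = 0.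
Proof.
transitivity (p1 0 * g2 0 + p2 0 * g1 0); last first.
  rewrite /p1 /p2 /g1 /g2 At0 Bt0 !mulr0 expR0 cos0 sin0 !G_at0/=; ring.
apply: (@is_derive_0_segment (fun t => p1 t * g2 t + p2 t * g1 t)) => t t1.
apply: (is_derive_eq (is_deriveD (is_deriveM (dp1 t1) (dg2 t1)) (is_deriveM (dp2 t1) (dg1 t1)))); rewrite /GRing.scale/= !(g1E t1) !(g2E t1) /u /v.
by have := dpos t1; rewrite /d => dt; field; rewrite gt_eqF.
Qed.

(* The real part of the logarithm is written with the norm in [cln], and with
   half the logarithm of the squared norm in [A]. *)
Let cln_1x : cln (1 - x) = A 1 +i* B 1.
Proof.
rewrite /cln /A /B /d /x; congr (_ +i* _); last by rewrite /= !mul1r sub0r.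
rewrite normc_def /= mul1r sub0r sqrrN mul1r.
set e := _ + _; have e0 : 0 < e by have := @dpos 1; rewrite normr1 lexx /d !mul1r; exact.
have s0 : 0 < Num.sqrt e by rewrite sqrtr_gt0.
rewrite -[in RHS](sqr_sqrtr (ltW e0)) lnXn//; move: (ln _) => r; by field.
Qed.

(* Solving [(p1 + i p2) (g1 + i g2) = 1] for the series. *)
Let gE : g1 1 +i* g2 1 = cpow (1 - x) (- l).
Proof.
rewrite /cpow cln_1x.
have -> : (- l)%:C * (A 1 +i* B 1) = (- (l * A 1)) +i* (- (l * B 1)).
  by apply/eqP; rewrite eq_complex/=; apply/andP; split; apply/eqP; ring.
rewrite /cexp [complex.Re _]/= [complex.Im _]/= cosN sinN expRN.
have := conserved_re; have := conserved_im; rewrite /p1 /p2.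
have cs := cos2Dsin2 (l * B 1).
have e0 : expR (l * A 1) != 0 by rewrite gt_eqF// expR_gt0.
move: (expR _) (cos _) (sin _) (g1 1) (g2 1) cs e0 => e c s y1 y2 cs e0 im re.
have -> : y1 = c / e.
  apply: (mulfI e0); rewrite [RHS]mulrC divfK// -[LHS]mulr1 -cs.
  have -> : e * y1 * (c ^+ 2 + s ^+ 2) = c * (e * c * y1 - e * s * y2)
     + s * (e * c * y2 + e * s * y1) by ring.
  by rewrite im re; ring.
have -> : y2 = - s / e.
  apply: (mulfI e0); rewrite [RHS]mulrC divfK// -[LHS]mulr1 -cs.
  have -> : e * y2 * (c ^+ 2 + s ^+ 2) = c * (e * c * y2 + e * s * y1)
     - s * (e * c * y1 - e * s * y2) by ring.
  by rewrite im re; ring.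
by apply/eqP; rewrite eq_complex/=; apply/andP; split; apply/eqP; ring.
Qed.

Lemma cpow_series_components :
  (\sum_(k < m) nbc l k * complex.Re (x ^+ k)) @[m --> \oo] -->
     complex.Re (cpow (1 - x) (- l)) /\
  (\sum_(k < m) nbc l k * complex.Im (x ^+ k)) @[m --> \oo] -->
     complex.Im (cpow (1 - x) (- l)).
Proof.
have x11 : nrm x * `|1| < 1 by rewrite normr1 mulr1.
rewrite -gE; split => /=; [have := @GE l 1 x 1 l0 x11|
  have := @GE l (0 +i* (-1)) x 1 l0 x11].
- apply: cvg_trans; apply: near_eq_cvg; apply: nearW => m.
  rewrite /series/= big_mkord; apply: eq_bigr => k _.
  by rewrite /coef mul1r expr1n mulr1.
- apply: cvg_trans; apply: near_eq_cvg; apply: nearW => m.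
  rewrite /series/= big_mkord; apply: eq_bigr => k _.
  rewrite /coef expr1n mulr1; congr (_ * _).
  by case: (x ^+ k) => y z /=; ring.
Qed.
End power_path.

End binomial_ode.

(** * Limits of sequences of complex numbers *)

(** Convergence of sequences in the topology of a numeric field; stated over an
    abstract field so that it can be used at [R[i]], which only carries this
    topology through its structure of numeric field. *)
Definition seqlim (K : numFieldType) (u : nat -> K) (l : K) : Prop :=
  u @ \oo --> l.

Section seqlim_theory.
Variable K : numFieldType.
Implicit Types (u v : nat -> K) (a b : K).

Lemma seqlimP u a : seqlim u a <->
  forall e, 0 < e -> exists N, forall m, (N <= m)%N -> `|u m - a| < e.
Proof.
split=> [/cvgrPdist_lt ua e /ua [N _ HN]|H].
  by exists N => m Nm; rewrite distrC; exact: HN.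
apply/cvgrPdist_lt => e /H [N HN]; exists N => // m Nm.
by rewrite distrC; exact: HN.
Qed.

Lemma seqlim_cst a : seqlim (fun=> a) a.
Proof. exact: cvg_cst. Qed.

Lemma seqlimD u v a b : seqlim u a -> seqlim v b -> seqlim (fun m => u m + v m) (a + b).
Proof. exact: cvgD. Qed.

Lemma seqlimM u v a b : seqlim u a -> seqlim v b -> seqlim (fun m => u m * v m) (a * b).
Proof. exact: cvgM. Qed.

Lemma seqlimZ u a b : seqlim u a -> seqlim (fun m => b * u m) (b * a).
Proof. by move=> ua; apply: seqlimM => //; exact: seqlim_cst. Qed.

Lemma seqlimB u v a b : seqlim u a -> seqlim v b -> seqlim (fun m => u m - v m) (a - b).
Proof. exact: cvgB. Qed.

Lemma seqlim_unique u a b : seqlim u a -> seqlim u b -> a = b.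
Proof. by move=> ua ub; apply: cvg_unique ua ub; exact: norm_hausdorff. Qed.

Lemma seqlim_sum (I : finType) (u : I -> nat -> K) (a : I -> K) :
  (forall i, seqlim (u i) (a i)) -> seqlim (fun m => \sum_i u i m) (\sum_i a i).
Proof.
move=> ua; elim: (index_enum I) => [|i s IH].
  by under eq_fun do rewrite big_nil; rewrite big_nil; exact: seqlim_cst.
by under eq_fun do rewrite big_cons; rewrite big_cons; exact: seqlimD.
Qed.

Lemma seqlim_prod (I : finType) (u : I -> nat -> K) (a : I -> K) :
  (forall i, seqlim (u i) (a i)) -> seqlim (fun m => \prod_i u i m) (\prod_i a i).
Proof.
move=> ua; elim: (index_enum I) => [|i s IH].
  by under eq_fun do rewrite big_nil; rewrite big_nil; exact: seqlim_cst.
by under eq_fun do rewrite big_cons; rewrite big_cons; exact: seqlimM.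
Qed.

Lemma seqlim_subseq u a (f : nat -> nat) :
  (forall m, (m <= f m)%N) -> seqlim u a -> seqlim (fun m => u (f m)) a.
Proof.
move=> fm /seqlimP ua; apply/seqlimP => e /ua [N HN].
by exists N => m Nm; apply: HN; exact: leq_trans (fm m).
Qed.

Lemma eq_seqlim u v a : u =1 v -> seqlim u a -> seqlim v a.
Proof. by move=> /funext ->. Qed.

End seqlim_theory.

Section seqlim_complex.
Variable R : realType.
Implicit Types (u v : nat -> R[i]) (a b : R[i]) (r : nat -> R).

Lemma seqlim_nrmP u a : seqlim u a <->
  forall e : R, 0 < e -> exists N, forall m, (N <= m)%N -> nrm (u m - a) < e.
Proof.
split=> [/seqlimP ua e e0|ua].
  have [|N HN] := ua e%:C; first by rewrite ltcR.
  by exists N => m /HN; rewrite nrmlt.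
apply/seqlimP => e e0; have eE : e = (complex.Re e)%:C.
  by rewrite RRe_real// ger0_real// ltW.
have [|N HN] := ua (complex.Re e); first by rewrite -ltcR -eE.
by exists N => m /HN; rewrite eE nrmlt.
Qed.

Lemma seqlim_dom u a r : (forall m, nrm (u m - a) <= r m) -> seqlim r 0 ->
  seqlim u a.
Proof.
move=> ur /seqlimP r0; apply/seqlim_nrmP => e /r0 [N HN].
exists N => m /HN; rewrite subr0; apply: le_lt_trans.
by apply: (le_trans (ur m)); exact: ler_norm.
Qed.

Lemma seqlim_ReIm u a : seqlim (fun m => complex.Re (u m)) (complex.Re a) ->
  seqlim (fun m => complex.Im (u m)) (complex.Im a) -> seqlim u a.
Proof.
move=> /seqlimP rea /seqlimP ima; apply/seqlim_nrmP => e e0.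
have e20 : 0 < e / 2 by rewrite divr_gt0.
have [N HN] := rea _ e20; have [M HM] := ima _ e20.
exists (maxn N M) => m; rewrite geq_max => /andP[/HN Nm /HM Mm].
rewrite [e]splitr; apply: le_lt_trans (ltrD Nm Mm).
have -> : u m - a = (complex.Re (u m) - complex.Re a)%:C +
    (complex.Im (u m) - complex.Im a)%:C * 'i%C.
  case: (u m) (a) => x y [x' y'] /=.
  by apply/eqP; rewrite eq_complex/=; apply/andP; split; apply/eqP; ring.
apply: (le_trans (nrmD _ _)); rewrite nrmM !nrm_real.
by rewrite (_ : nrm 'i%C = 1) ?mulr1// normc_def/= expr0n expr1n add0r sqrtr1.
Qed.

Lemma seqlim_ge_nrm u a b (e : R) N : seqlim u a ->
  (forall m, (N <= m)%N -> nrm (u m - b) <= e) -> nrm (a - b) <= e.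
Proof.
move=> /seqlim_nrmP ua ub; apply/ler_addgt0Pr => d d0.
have [M HM] := ua d d0; have [] := (HM (maxn M N), ub (maxn M N)).
rewrite leq_maxl leq_maxr => /(_ isT) h1 /(_ isT) h2.
have -> : a - b = (- 1)%:C * (u (maxn M N) - a) + (u (maxn M N) - b).
  by rewrite rmorphN1; ring.
apply: (le_trans (nrmD _ _)); rewrite nrmM nrm_real normrN normr1 mul1r addrC.
by rewrite lerD// ltW.
Qed.

Lemma seqlim_Re u a : seqlim u a -> seqlim (fun m => complex.Re (u m)) (complex.Re a).
Proof.
move=> /seqlim_nrmP ua; apply/seqlimP => e /ua [N HN]; exists N => m /HN.
by rewrite -raddfB; apply: le_lt_trans; exact: Re_le_nrm.
Qed.

(** The binomial series in the open unit disc, for the principal branch. *)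
Lemma cpow_series (l : R) (x : R[i]) : 0 < l -> nrm x < 1 ->
  seqlim (fun m => \sum_(k < m) (nbc l k)%:C * x ^+ k) (cpow (1 - x) (- l)).
Proof.
case: x => a b l0 x1; have [re im] := cpow_series_components x1 l0.
apply: seqlim_ReIm.
- apply: eq_seqlim re => m; rewrite raddf_sum; apply: eq_bigr => k _.
  exact/esym/Re_realM.
- apply: eq_seqlim im => m; rewrite raddf_sum; apply: eq_bigr => k _.
  exact/esym/Im_realM.
Qed.

End seqlim_complex.

(** * Averages over dyadic roots of unity *)

Section roots_of_unity.
Variable C : numClosedFieldType.

(** A primitive root of unity of order [2 ^ i.+1], by repeated square roots of
    [-1]. Powers of two make the grids nested. *)
Fixpoint dyadic_root (i : nat) : C :=
  if i is i'.+1 then sqrtC (dyadic_root i') else -1.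

Let dyadic_rootX i : dyadic_root i ^+ (2 ^ i) = -1.
Proof. by elim: i => [|i IH] //=; rewrite expnS exprM sqrtCK. Qed.

Lemma norm_dyadic_root i : `|dyadic_root i| = 1.
Proof.
have : `|dyadic_root i| ^+ (2 ^ i) = 1 by rewrite -normrX dyadic_rootX normrN1.
by move/eqP; rewrite pexpr_eq1 ?expn_gt0// => /eqP.
Qed.

Lemma dyadic_root_primitive i : (2 ^ i.+1).-primitive_root (dyadic_root i).
Proof.
have zN : dyadic_root i ^+ (2 ^ i.+1) = 1.
  by rewrite expnSr exprM dyadic_rootX sqrrN expr1n.
have [m prim_m mN] := prim_order_exists (expn_gt0 2 i.+1) zN.
have [k ki mE] := elimT (@dvdn_pfactor 2 m i.+1 isT) mN.
move: ki; rewrite leq_eqVlt => /predU1P[<-|]; first by rewrite -mE.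
(* A smaller order would divide [2 ^ i], but the power [2 ^ i] is [-1]. *)
rewrite ltnS => ki; have : dyadic_root i ^+ (2 ^ i) = 1.
  apply/eqP; rewrite -(prim_order_dvd prim_m) mE dvdn_exp2l//.
by rewrite dyadic_rootX => /eqP; rewrite eq_sym -addr_eq0 -mulr2n pnatr_eq0.
Qed.

(** Orthogonality of the characters of a cyclic group: the quotient of two
    characters is constant, or its geometric sum vanishes. *)
Lemma dyadic_average i l m :
  \sum_(j < 2 ^ i.+1) (dyadic_root i ^+ (m * j) / (2 ^ i.+1)%:R)^* *
     dyadic_root i ^+ (l * j) = (l == m %[mod 2 ^ i.+1])%:R.
Proof.
set N := (2 ^ i.+1)%N; set z := dyadic_root i.
have N0 : N%:R != 0 :> C by rewrite pnatr_eq0 expn_eq0.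
have z0 : z != 0 by rewrite -normr_eq0 norm_dyadic_root oner_eq0.
have zC : z^* = z^-1.
  by apply: (mulfI z0); rewrite -normCK norm_dyadic_root expr1n divff.
pose q := z ^+ l / z ^+ m.
under eq_bigr => j _.
  rewrite fmorph_div rmorphXn/= zC rmorph_nat mulrAC.
  rewrite exprVn (exprM _ m) (exprM _ l) [X in X / _]mulrC -expr_div_n -/q.
  over.
rewrite -mulr_suml.
have qN : q ^+ N = 1.
  by rewrite /q expr_div_n -!exprM ![(_ * N)%N]mulnC !exprM
    (prim_expr_order (dyadic_root_primitive i)) !expr1n divr1.
rewrite -(eq_prim_root_expr (dyadic_root_primitive i)) -/z.
have [E|zlm] := eqVneq (z ^+ l) (z ^+ m).
  have q1 : q = 1 by rewrite /q E divff// expf_neq0.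
  under eq_bigr do rewrite q1 expr1n.
  by rewrite sumr_const card_ord divff.
have : q - 1 != 0.
  apply: contraNneq zlm => /eqP; rewrite subr_eq0 /q => /eqP E.
  by rewrite -[z ^+ l](divfK (expf_neq0 m z0)) E mul1r.
move=> /mulfI; apply; rewrite mulr0 mulrA -subrX1 qN subrr mul0r //.
Qed.

End roots_of_unity.

(** * Isolating one coefficient of the one-variable kernel *)

Section dyadic_grid.
Variables (R : realType) (l : R).
Hypothesis l0 : 0 < l.
Implicit Types x w : R[i].

(** Any radius in the open unit interval would serve; it only has to keep the
    points inside the disc and away from [0]. *)
Definition grid i j : R[i] := (2^-1)%:C * dyadic_root R[i] i ^+ j.

(** Averaging weights: a character of the grid, normalized by its cardinality. *)
Definition twist i m j : R[i] := dyadic_root R[i] i ^+ (m * j) / (2 ^ i.+1)%:R.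

Definition power_kernel x w : R[i] := cpow (1 - x * w^*) (- l).

(** The combination of kernels whose expansion keeps the exponents congruent to
    [m] modulo [2 ^ i.+1]. *)
Definition filtered_kernel i m x : R[i] :=
  \sum_(j < 2 ^ i.+1) twist i m j * power_kernel x (grid i j).

Lemma nrm_grid i j : nrm (grid i j) = 2^-1.
Proof.
rewrite /grid nrmM nrm_real nrmX (_ : nrm (dyadic_root _ _) = 1).
  by rewrite expr1n mulr1 ger0_norm// invr_ge0.
by rewrite norm_dyadic_root.
Qed.

Lemma grid_average i m k :
  \sum_(j < 2 ^ i.+1) (twist i m j)^* * grid i j ^+ k =
  (2^-1)%:C ^+ k * (k == m %[mod 2 ^ i.+1])%:R.
Proof.
rewrite -(dyadic_average R[i]) mulr_sumr; apply: eq_bigr => j _.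
by rewrite /grid /twist exprMn mulrCA -exprM (mulnC j k).
Qed.

Lemma conj_real_complex (r : R) : (r%:C)^* = r%:C.
Proof. by apply: conj_Creal; apply/complex_realP; exists r. Qed.

Lemma nrm_conj x : nrm (x^*) = nrm x.
Proof. by rewrite norm_conjC. Qed.

Lemma power_kernel_series x w : nrm x < 1 -> nrm w < 1 ->
  seqlim (fun L => \sum_(k < L) (nbc l k)%:C * (x ^+ k * w^* ^+ k)) (power_kernel x w).
Proof.
move=> x1 w1; apply: eq_seqlim (cpow_series l0 _) => [L|].
  by apply: eq_bigr => k _; rewrite exprMn.
by rewrite nrmM nrm_conj (le_lt_trans _ x1)// ler_piMr ?nrm_ge0// ltW.
Qed.

Lemma filtered_kernel_series i m x : nrm x < 1 ->
  seqlim (fun L => \sum_(k < L) (nbc l k)%:C * (x / 2) ^+ k *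
                     (k == m %[mod 2 ^ i.+1])%:R) (filtered_kernel i m x).
Proof.
move=> x1; rewrite /filtered_kernel.
have grid1 j : nrm (grid i j) < 1 by rewrite nrm_grid invf_lt1// ltr1n.
have := seqlim_sum (fun j : 'I_(2 ^ i.+1) =>
  seqlimZ (b := twist i m j) (power_kernel_series x1 (grid1 j))).
apply: eq_seqlim => L.
under eq_bigr do rewrite mulr_sumr.
rewrite exchange_big; apply: eq_bigr => k _ /=.
rewrite (eq_bigr (fun j : 'I_(2 ^ i.+1) => (nbc l k)%:C * x ^+ k *
  (twist i m j * (grid i j)^* ^+ k))); last by move=> j _; ring.
rewrite -mulr_sumr exprMn -!mulrA; congr (_ * (_ * _)).
have := congr1 Num.conj (grid_average i m k).
rewrite rmorphM rmorphXn/= conj_real_complex conjC_nat rmorph_sum/= => E.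
rewrite (_ : 2^-1 = (2^-1)%:C :> R[i]); last by rewrite fmorphV/= rmorph_nat.
rewrite -E; apply: eq_bigr => j _.
by rewrite [RHS]rmorphM/= conjCK [in RHS]rmorphXn.
Qed.

(** For a fine grid the only exponent below [2 ^ i.+1] in the residue class of [m]
    is [m] itself; the others are controlled by a tail of the convergent series of
    the [c_k q^k]. *)
Lemma filtered_kernel_lim m x : nrm x < 1 ->
  seqlim (fun i => filtered_kernel i m x) ((nbc l m)%:C * (x / 2) ^+ m).
Proof.
move=> x1; set q := nrm (x / 2).
have q01 : 0 <= q < 1.
  rewrite nrm_ge0 /q nrmM (_ : nrm (2^-1) = 2^-1).
    by have := nrm_ge0 x; lra.
  by rewrite (_ : 2^-1 = (2^-1)%:C :> R[i]) ?nrm_real ?ger0_norm ?invr_ge0// fmorphV/= rmorph_nat.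
have c0 k : 0 <= nbc l k * q ^+ k.
  by case/andP: q01 => q0 _; rewrite mulr_ge0 ?exprn_ge0// ltW// nbc_gt0.
pose s n := series (fun k => nbc l k * q ^+ k) n.
have scvg : cvgn s by exact: is_cvg_nbc_series.
have sle n : s n <= limn s.
  by apply: nondecreasing_cvgn_le => //; apply: nondecreasing_series => k _ _; exact: c0.
have N_large i : (i <= 2 ^ i.+1)%N.
  by rewrite ltnW// (leq_trans (ltn_expl i (ltnSn 1)))// leq_exp2l.
have bound i : (m < 2 ^ i.+1)%N ->
    nrm (filtered_kernel i m x - (nbc l m)%:C * (x / 2) ^+ m) <= limn s - s (2 ^ i.+1)%N.
  move=> mN; apply: (seqlim_ge_nrm (N := (2 ^ i.+1)%N) (filtered_kernel_series (i := i) (m := m) x1)) => L NL.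
  have [M LE] : exists M, L = (2 ^ i.+1 + M)%N by exists (L - 2 ^ i.+1)%N; rewrite subnKC.
  rewrite {}LE {NL}.
  have -> : \sum_(k < 2 ^ i.+1 + M) (nbc l k)%:C * (x / 2) ^+ k *
          (k == m %[mod 2 ^ i.+1])%:R =
      (nbc l m)%:C * (x / 2) ^+ m + \sum_(k < M) (nbc l (2 ^ i.+1 + k))%:C *
        (x / 2) ^+ (2 ^ i.+1 + k) * (2 ^ i.+1 + k == m %[mod 2 ^ i.+1])%:R.
    rewrite big_split_ord/=; congr (_ + _).
    rewrite (bigD1 (Ordinal mN))//= eqxx mulr1 big1 ?addr0// => k.
    by rewrite -val_eqE/= => km; rewrite !modn_small// (negbTE km) mulr0.
  rewrite addrAC subrr add0r.
  apply: (@le_trans _ _ (s (2 ^ i.+1 + M)%N - s (2 ^ i.+1)%N)); last first.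
    by rewrite lerD2r.
  rewrite /s /series/= !big_mkord big_split_ord/= addrAC subrr add0r.
  apply: (le_trans (nrm_sum _)); apply: ler_sum => k _.
  rewrite 2!nrmM nrm_real ger0_norm ?(ltW (nbc_gt0 _ _))// nrmX -/q -[leRHS]mulr1.
  apply: ler_wpM2l; first exact: c0.
  by case: (_ == _); rewrite ?normr1 ?normr0 ?ler01.
have : seqlim (fun i => limn s - s (2 ^ i.+1)%N) 0.
  rewrite -(subrr (limn s)); apply: seqlimB; first exact: seqlim_cst.
  by apply: (seqlim_subseq (f := fun i => (2 ^ i.+1)%N)) scvg.
move=> /seqlimP tail0; apply/seqlim_nrmP => e /tail0 [N HN].
exists (maxn N m) => i; rewrite geq_max => /andP[Ni mi].
apply: le_lt_trans (bound i _) _.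
  by rewrite (leq_ltn_trans mi)// (leq_trans (ltn_expl i (ltnSn 1)))// leq_exp2l.
by have := HN i Ni; rewrite subr0; apply: le_lt_trans; exact: ler_norm.
Qed.

(** Filtering twice along nested grids keeps the finer of the two residue classes.
    Through the reproducing property the left-hand side is an inner product of two
    filtered kernels, and it depends only on the finer grid. *)
Lemma filtered_kernel_gram i i' m :
  \sum_(j < 2 ^ i.+1) (twist i m j)^* * filtered_kernel i' m (grid i j) =
  filtered_kernel (maxn i i') m (2^-1)%:C.
Proof.
have grid1 j : nrm (grid i j) < 1 by rewrite nrm_grid invf_lt1// ltr1n.
have half1 : nrm ((2^-1)%:C : R[i]) < 1.
  by rewrite nrm_real ger0_norm ?invr_ge0// invf_lt1// ltr1n.
have h1 := seqlim_sum (fun j : 'I_(2 ^ i.+1) =>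
  seqlimZ (b := (twist i m j)^*) (filtered_kernel_series (i := i') (m := m) (grid1 j))).
apply: (seqlim_unique h1); apply: eq_seqlim (filtered_kernel_series half1).
move=> L; under [RHS]eq_bigr do rewrite mulr_sumr.
rewrite exchange_big; apply: eq_bigr => k _ /=.
rewrite (eq_bigr (fun j : 'I_(2 ^ i.+1) => (nbc l k)%:C * 2^-1 ^+ k *
    (k == m %[mod 2 ^ i'.+1])%:R * ((twist i m j)^* * grid i j ^+ k))); last first.
  by move=> j _; rewrite exprMn; ring.
rewrite -mulr_sumr grid_average exprMn.
have AC (a b c d e : R[i]) : a * b * c * (d * e) = a * (d * b) * (e * c) by ring.
rewrite {}AC; congr (_ * _); rewrite -natrM mulnb; congr (_%:R).
have mod_dvd a b : (a <= b)%N -> (k == m %[mod 2 ^ b.+1]) -> (k == m %[mod 2 ^ a.+1]).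
  move=> ab /eqP E; have d : (2 ^ a.+1 %| 2 ^ b.+1)%N by rewrite dvdn_exp2l.
  by rewrite -(modn_dvdm k d) -(modn_dvdm m d) E.
have [ii'|/ltnW ii'] := leqP i i'.
- by have [/(mod_dvd _ _ ii') ->|] := boolP (k == m %[mod 2 ^ i'.+1]); rewrite ?andbF.
- by have [/(mod_dvd _ _ ii') ->|] := boolP (k == m %[mod 2 ^ i.+1]).
Qed.

End dyadic_grid.

(** * Elementary Hilbert space theory *)

Section hilbert_theory.
Variables (R : realType) (X : Type) (H : fspace R X).
Hypothesis hH : is_hilbert H.
Implicit Types (f g h : X -> R[i]) (a b : R[i]).

Lemma hilbert0 : H (fun=> 0).
Proof. by case: hH => -[]. Qed.

Lemma hilbert_lin a f g : H f -> H g -> H (fun x => a * f x + g x).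
Proof. by case: hH => -[_ h] *; exact: h. Qed.

Lemma hilbertZ a f : H f -> H (fun x => a * f x).
Proof.
move=> Hf; have := hilbert_lin a Hf hilbert0.
by congr (H _); apply/funext => x; rewrite addr0.
Qed.

Lemma hilbertD f g : H f -> H g -> H (fun x => f x + g x).
Proof.
move=> Hf Hg; have := hilbert_lin 1 Hf Hg.
by congr (H _); apply/funext => x; rewrite mul1r.
Qed.

Lemma hilbertB f g : H f -> H g -> H (fun x => f x - g x).
Proof.
move=> Hf Hg; have := hilbert_lin (-1) Hg Hf.
by congr (H _); apply/funext => x; rewrite mulN1r addrC.
Qed.

Lemma hilbert_sum (I : Type) (s : seq I) (c : I -> R[i]) (F : I -> X -> R[i]) :
  (forall i, H (F i)) -> H (fun x => \sum_(i <- s) c i * F i x).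
Proof.
move=> HF; elim: s => [|i s IH].
  by under eq_fun do rewrite big_nil; exact: hilbert0.
by under eq_fun do rewrite big_cons; exact: hilbert_lin.
Qed.

Lemma inner_lin a f g h : H f -> H g -> H h ->
  inner H (fun x => a * f x + g x) h = a * inner H f h + inner H g h.
Proof. by case: hH => _ h1 *; exact: h1. Qed.

Lemma innerC f g : H f -> H g -> inner H g f = (inner H f g)^*.
Proof. by case: hH => _ _ h1 *; exact: h1. Qed.

Lemma inner_ge0 f : H f -> 0 <= inner H f f.
Proof. by case: hH => _ _ _ h1 _ /h1[]. Qed.

Lemma inner_eq0 f : H f -> inner H f f = 0 -> f = fun=> 0.
Proof. by case: hH => _ _ _ h1 _ /h1[]. Qed.

Lemma inner0l h : H h -> inner H (fun=> 0) h = 0.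
Proof.
move=> Hh; have := inner_lin 1 hilbert0 hilbert0 Hh.
under eq_fun do rewrite mulr0 addr0.
by rewrite mul1r => /eqP; rewrite -subr_eq0 opprD addrA subrr sub0r oppr_eq0 => /eqP.
Qed.

Lemma innerZl a f h : H f -> H h -> inner H (fun x => a * f x) h = a * inner H f h.
Proof.
move=> Hf Hh; rewrite -[RHS]addr0 -(inner0l Hh) -(inner_lin a Hf hilbert0 Hh).
by congr (inner H _ _); apply/funext => x; rewrite addr0.
Qed.

Lemma innerDl f g h : H f -> H g -> H h ->
  inner H (fun x => f x + g x) h = inner H f h + inner H g h.
Proof.
move=> Hf Hg Hh; rewrite -[inner H f h]mul1r -inner_lin//.
by congr (inner H _ _); apply/funext => x; rewrite mul1r.
Qed.

Lemma innerBl f g h : H f -> H g -> H h ->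
  inner H (fun x => f x - g x) h = inner H f h - inner H g h.
Proof.
move=> Hf Hg Hh; rewrite addrC -mulN1r -inner_lin//.
by congr (inner H _ _); apply/funext => x; rewrite mulN1r addrC.
Qed.

Lemma inner_suml (I : Type) (s : seq I) (c : I -> R[i]) (F : I -> X -> R[i]) h :
  (forall i, H (F i)) -> H h ->
  inner H (fun x => \sum_(i <- s) c i * F i x) h = \sum_(i <- s) c i * inner H (F i) h.
Proof.
move=> HF Hh; elim: s => [|i s IH].
  by under eq_fun do rewrite big_nil; rewrite big_nil inner0l.
under eq_fun do rewrite big_cons.
by rewrite big_cons inner_lin ?IH//; exact: hilbert_sum.
Qed.

Lemma innerZr a f h : H f -> H h -> inner H h (fun x => a * f x) = a^* * inner H h f.
Proof.
move=> Hf Hh; rewrite (innerC _ Hh); last exact: hilbertZ.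
by rewrite innerZl// rmorphM/= -innerC.
Qed.

Lemma innerBr f g h : H f -> H g -> H h ->
  inner H h (fun x => f x - g x) = inner H h f - inner H h g.
Proof.
move=> Hf Hg Hh; rewrite (innerC _ Hh); last exact: hilbertB.
by rewrite innerBl// rmorphB/= -!innerC.
Qed.

Lemma innerDr f g h : H f -> H g -> H h ->
  inner H h (fun x => f x + g x) = inner H h f + inner H h g.
Proof.
move=> Hf Hg Hh; rewrite (innerC _ Hh); last exact: hilbertD.
by rewrite innerDl// rmorphD/= -!innerC.
Qed.

Lemma inner_sumr (I : Type) (s : seq I) (c : I -> R[i]) (F : I -> X -> R[i]) h :
  (forall i, H (F i)) -> H h ->
  inner H h (fun x => \sum_(i <- s) c i * F i x) =
  \sum_(i <- s) (c i)^* * inner H h (F i).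
Proof.
move=> HF Hh; rewrite (innerC _ Hh); last exact: hilbert_sum.
rewrite inner_suml// rmorph_sum/=; apply: eq_bigr => i _.
by rewrite rmorphM/= -innerC.
Qed.

Lemma hnorm_ge0 f : 0 <= hnorm H f.
Proof. exact: sqrtr_ge0. Qed.

Lemma hnorm_sqr f : H f -> (hnorm H f ^+ 2)%:C = inner H f f.
Proof.
move=> Hf; have f0 := inner_ge0 Hf.
rewrite sqr_sqrtr ?RRe_real ?ger0_real//.
by rewrite -ler0c RRe_real// ger0_real.
Qed.

Lemma hnorm_eq0 f : H f -> hnorm H f = 0 -> f = fun=> 0.
Proof.
by move=> Hf f0; apply: inner_eq0 => //; rewrite -hnorm_sqr// f0 expr0n.
Qed.

(** Positivity of the squared norm of the component of [f] orthogonal to [g]. *)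
Lemma cauchy_schwarz f g : H f -> H g -> nrm (inner H f g) <= hnorm H f * hnorm H g.
Proof.
move=> Hf Hg; have [g0|g0] := eqVneq (hnorm H g) 0.
  rewrite (hnorm_eq0 Hg g0) innerC ?inner0l//; last exact: hilbert0.
  by rewrite conjC0 normr0 mulr_ge0// hnorm_ge0.
have gg0 : (hnorm H g ^+ 2)%:C != 0 by rewrite -(rmorph0 (real_complex R)) (inj_eq (@complexI _)) expf_neq0.
pose c := inner H f g / (hnorm H g ^+ 2)%:C.
have Hcg : H (fun x => c * g x) by exact: hilbertZ.
have := inner_ge0 (hilbertB Hf Hcg).
rewrite innerBl ?innerBr//; last exact: hilbertB.
rewrite !innerZl ?innerZr// -!hnorm_sqr// (innerC Hf Hg).
have cC : c^* = (inner H f g)^* / (hnorm H g ^+ 2)%:C.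
  by rewrite /c fmorph_div/= conj_real_complex.
rewrite cC; set z := inner H f g; set G := (hnorm H g ^+ 2)%:C.
have -> : (hnorm H f ^+ 2)%:C - z^* / G * z - (c * z^* - c * (z^* / G * G)) =
  ((hnorm H f ^+ 2) - nrm z ^+ 2 / hnorm H g ^+ 2)%:C.
  rewrite divfK// subrr subr0 rmorphB/=; congr (_ - _).
  rewrite fmorph_div/= (rmorphXn _ 2 (nrm z)) /= nrmE normCK -/G.
  by rewrite mulrAC [z * _]mulrC.
rewrite ler0c subr_ge0 ler_pdivrMr ?exprn_gt0// ?lt0r ?g0 ?hnorm_ge0// -exprMn.
by rewrite ler_sqr// nnegrE ?nrm_ge0// mulr_ge0// hnorm_ge0.
Qed.

Lemma hnormZ a f : H f -> hnorm H (fun x => a * f x) = nrm a * hnorm H f.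
Proof.
move=> Hf; apply/eqP; rewrite -(@eqrXn2 _ 2)// ?hnorm_ge0// ?mulr_ge0 ?nrm_ge0 ?hnorm_ge0//.
apply/eqP/complexI; rewrite hnorm_sqr; last exact: hilbertZ.
rewrite innerZl ?innerZr//; last exact: hilbertZ.
by rewrite exprMn rmorphM/= hnorm_sqr// (rmorphXn _ 2 (nrm a))/= nrmE normCK mulrA.
Qed.

Lemma hnormD f g : H f -> H g -> hnorm H (fun x => f x + g x) <= hnorm H f + hnorm H g.
Proof.
move=> Hf Hg; rewrite -(@ler_pXn2r _ 2)// ?nnegrE ?hnorm_ge0// ?addr_ge0 ?hnorm_ge0//.
rewrite -lecR hnorm_sqr; last exact: hilbertD.
rewrite innerDl ?innerDr//; last exact: hilbertD.
rewrite -!hnorm_sqr// (innerC Hf Hg) addrA -(addrA _ (inner H f g)).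
have -> : inner H f g + (inner H f g)^* = (2 * complex.Re (inner H f g))%:C.
  by case: (inner H f g) => x y; apply/eqP; rewrite eq_complex/=; apply/andP; split; apply/eqP; ring.
rewrite -!rmorphD lecR sqrrD.
have := le_trans (le_trans (ler_norm _) (Re_le_nrm (inner H f g))) (cauchy_schwarz Hf Hg).
rewrite -mulr_natl; lra.
Qed.

Definition hlim (u : nat -> X -> R[i]) f : Prop :=
  seqlim (fun m => hnorm H (fun x => u m x - f x)) 0.

Lemma hlim_inner u f g : (forall m, H (u m)) -> H f -> H g -> hlim u f ->
  seqlim (fun m => inner H (u m) g) (inner H f g).
Proof.
move=> Hu Hf Hg uf; apply: (@seqlim_dom _ _ _
  (fun m => hnorm H (fun x => u m x - f x) * hnorm H g)) => [m|].
  by rewrite -innerBl//; apply: cauchy_schwarz => //; exact: hilbertB.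
by rewrite -(mul0r (hnorm H g)); apply: seqlimM => //; exact: seqlim_cst.
Qed.

Lemma hlim_hnorm_le u f (r : nat -> R) (B : R) : (forall m, H (u m)) -> H f -> hlim u f ->
  (forall m, hnorm H (u m) <= r m) -> seqlim r B -> hnorm H f <= B.
Proof.
move=> Hu Hf uf ur rB; apply/ler_addgt0Pr => e e0.
have e20 : 0 < e / 2 by rewrite divr_gt0.
have /seqlimP/(_ _ e20)[N HN] := uf; have /seqlimP/(_ _ e20)[M HM] := rB.
have := HN _ (leq_maxl N M); have := HM _ (leq_maxr N M).
set m := maxn N M; rewrite subr0 => h1 h2.
have : hnorm H f <= hnorm H (fun x => u m x - f x) + hnorm H (u m).
  have Huf := hilbertB (Hu m) Hf.
  have -> : f = fun x => (-1) * (u m x - f x) + u m x.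
    by apply/funext => x; rewrite mulN1r opprB subrK.
  apply: (le_trans (hnormD (hilbertZ (-1) Huf) (Hu m))); rewrite hnormZ//.
  rewrite (_ : nrm (-1) = 1) ?mul1r; last by rewrite normrN1.
  rewrite lerD2r le_eqVlt; apply/orP; left; apply/eqP; congr (hnorm H _).
  by apply/funext => x; ring.
have := ur m; have := ler_norm (r m - B); have := ler_norm (hnorm H (fun x => u m x - f x)).
lra.
Qed.

Lemma hilbert_complete u : (forall m, H (u m)) ->
  (forall e : R, 0 < e -> exists N, forall m p, (N <= m)%N -> (N <= p)%N ->
     hnorm H (fun x => u m x - u p x) < e) ->
  exists2 f, H f & hlim u f.
Proof. by case: hH => _ _ _ _; exact. Qed.

End hilbert_theory.

Section rkhs_theory.
Variables (R : realType) (X : Type) (H : fspace R X) (K : X -> X -> R[i]).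
Hypothesis hK : is_rkhs H K.

(** Evaluation at [x] is the inner product with the kernel at [x]. *)
Lemma hlim_pointwise u f x : (forall m, H (u m)) -> H f -> hlim H u f ->
  seqlim (fun m => u m x) (f x).
Proof.
case: hK => hH hKx Hu Hf uf; have [HKx repr] := hKx x.
rewrite -(repr _ Hf); apply: eq_seqlim (hlim_inner hH Hu Hf HKx uf) => m.
exact: repr.
Qed.

End rkhs_theory.

(** * Orthonormal bases and square-summable families *)

Lemma seqlim_harmonic (R : realType) : seqlim (fun i => i.+1%:R^-1 : R) 0.
Proof. exact: (@cvg_harmonic R). Qed.

Lemma unconditional_sumE (K : numFieldType) (V : choiceType) (x : V -> K^o) (a : K) :
  (forall d : K, 0 < d -> exists S : {fset V}, forall T : {fset V}, (S `<=` T)%fset ->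
     `|a - \sum_(v <- T) x v| < d) ->
  summability.sum x = a.
Proof.
move=> xa; have totF := @summability.totally_filter V.
apply: cvg_lim; first exact: norm_hausdorff.
apply/cvgrPdist_lt => d /xa[S HS]; exists S => // T ST.
by have := HS T ST; rewrite /summability.partial_sum big_seq_fsetE.
Qed.

Section square_summable.
Variables (R : realType) (V : choiceType).
Implicit Types (g : V -> R[i]) (S : {fset V}).

Definition sqsum g S : R := \sum_(v <- S) nrm (g v) ^+ 2.

Lemma sqsum_subset g S T : (S `<=` T)%fset -> sqsum g S <= sqsum g T.
Proof.
move=> /fsubsetP ST; rewrite /sqsum [leRHS](bigID [in S])/=.
have -> : \sum_(v <- T | v \in S) nrm (g v) ^+ 2 = \sum_(v <- S) nrm (g v) ^+ 2.
  rewrite -big_filter; apply: perm_big; apply: uniq_perm => [||v].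
  - by rewrite filter_uniq.
  - exact: fset_uniq.
  - by rewrite mem_filter andb_idr// => /ST.
by rewrite lerDl; apply: sumr_ge0 => v _; rewrite sqr_ge0.
Qed.

(** The extended-real sum over [V] is a supremum over finite subsets; boundedness
    of the finite sums is the form used below. *)
Lemma ell2P g : ell2 R V g <-> exists M, forall S, sqsum g S <= M.
Proof.
pose a v : \bar R := (nrm (g v) ^+ 2)%:E.
have sumE S : (\sum_(v \in [set` S]) a v = (sqsum g S)%:E)%E.
  by rewrite fsbig_finite//= set_fsetK sumEFin.
rewrite /ell2/=; split=> [goo|[M HM]]; last first.
  apply: le_lt_trans (ltry M); apply: ge_ereal_sup => _ /= [A [finA _] <-].
  by rewrite -(fset_setK finA) sumE lee_fin.
have a0 : (0 <= \esum_(v in [set: V]) a v)%E.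
  by apply: esum_ge0 => v _; rewrite lee_fin sqr_ge0.
have afin : \esum_(v in [set: V]) a v \is a fin_num by rewrite ge0_fin_numE.
exists (fine (\esum_(v in [set: V]) a v)) => S.
rewrite -lee_fin fineK// -sumE; apply: ereal_sup_ubound.
by exists [set` S] => //; split.
Qed.

End square_summable.

Section orthonormal_basis.
Variables (R : realType) (X : Type) (H : fspace R X).
Hypothesis hH : is_hilbert H.
Variables (V : choiceType) (e : V -> X -> R[i]).
Hypothesis He : forall v, H (e v).
Hypothesis orthonormal_e : forall v w, inner H (e v) (e w) = (v == w)%:R.
Hypothesis complete_e : forall f, H f -> (forall v, inner H f (e v) = 0) -> f = fun=> 0.
Implicit Types (f g : X -> R[i]) (c : V -> R[i]) (S T : {fset V}).

Definition finite_expansion c S : X -> R[i] := fun x => \sum_(v <- S) c v * e v x.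

Lemma finite_expansion_in c S : H (finite_expansion c S).
Proof. exact: hilbert_sum. Qed.

Lemma inner_finite_expansion c S v :
  inner H (finite_expansion c S) (e v) = (v \in S)%:R * c v.
Proof.
rewrite inner_suml//; under eq_bigr do rewrite orthonormal_e.
have [vS|vS] := boolP (v \in S).
  rewrite mul1r (big_fsetD1 v)//= eqxx mulr1 big1_seq ?addr0// => w /andP[_].
  by rewrite in_fsetD1 => /andP[/negbTE -> _]; rewrite mulr0.
rewrite mul0r big1_seq// => w /andP[_ wS].
by rewrite (negbTE (memPn vS _ wS)) mulr0.
Qed.

Lemma inner_finite_expansions c S T : (S `<=` T)%fset ->
  inner H (finite_expansion c T) (finite_expansion c S) = (sqsum c S)%:C.
Proof.
move=> /fsubsetP ST; rewrite inner_sumr//; last exact: finite_expansion_in.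
rewrite rmorph_sum/=; apply: eq_big_seq => v vS.
rewrite inner_finite_expansion ST// mul1r (rmorphXn _ 2 (nrm (c v)))/= nrmE normCK.
by rewrite mulrC.
Qed.

Lemma hnorm_finite_expansion c S : hnorm H (finite_expansion c S) ^+ 2 = sqsum c S.
Proof.
apply: complexI; rewrite hnorm_sqr ?inner_finite_expansions//.
exact: finite_expansion_in.
Qed.

Lemma hnorm_finite_expansionB c S T : (S `<=` T)%fset ->
  hnorm H (fun x => finite_expansion c T x - finite_expansion c S x) ^+ 2 =
  sqsum c T - sqsum c S.
Proof.
move=> ST; apply: complexI; have HS := finite_expansion_in c S.
have HT := finite_expansion_in c T.
have hB := hilbertB hH HT HS.
rewrite hnorm_sqr// innerBl// !innerBr// (innerC hH HT HS).
by rewrite !inner_finite_expansions// conj_real_complex rmorphB/= subrr subr0.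
Qed.

(** Bessel's identity. *)
Lemma hnorm_residual f S : H f ->
  hnorm H (fun x => f x - finite_expansion (fun v => inner H f (e v)) S x) ^+ 2 =
  hnorm H f ^+ 2 - sqsum (fun v => inner H f (e v)) S.
Proof.
move=> Hf; apply: complexI; set c := (X in finite_expansion X); have HS := finite_expansion_in c S.
have hB := hilbertB hH Hf HS.
have fS : inner H f (finite_expansion c S) = (sqsum c S)%:C.
  rewrite inner_sumr// rmorph_sum/=; apply: eq_bigr => v _.
  by rewrite (rmorphXn _ 2 (nrm (c v)))/= nrmE normCK mulrC.
rewrite hnorm_sqr// innerBl// !innerBr// (innerC hH Hf HS) fS conj_real_complex.
by rewrite inner_finite_expansions// subrr subr0 rmorphB/= hnorm_sqr.
Qed.

Lemma bessel f S : H f -> sqsum (fun v => inner H f (e v)) S <= hnorm H f ^+ 2.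
Proof. by move=> Hf; rewrite -subr_ge0 -hnorm_residual// sqr_ge0. Qed.

Lemma fourier_ell2 f : H f -> ell2 R V (fun v => inner H f (e v)).
Proof. by move=> Hf; apply/ell2P; exists (hnorm H f ^+ 2) => S; exact: bessel. Qed.

(** Finite sets that nearly attain the supremum of the finite sums of [|c|^2] give
    a Cauchy sequence of expansions, because enlarging such a set moves the
    expansion very little; an index missed by the sets has a small coefficient for
    the same reason. This avoids enumerating [V]. *)
Lemma riesz_fischer c : ell2 R V c ->
  exists f (S : nat -> {fset V}), [/\ H f, forall v, inner H f (e v) = c v
    & hlim H (fun i => finite_expansion c (S i)) f].
Proof.
move=> /ell2P[M HM].
pose E := [set sqsum c S | S in [set: {fset V}]].
have supE : has_sup E.
  by split; [exists (sqsum c fset0), fset0|exists M => _ [S _ <-]].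
have /choice[S HS] : forall i, exists S, sup E - i.+1%:R^-1 < sqsum c S.
  move=> i; have [||_ [S _ <-] h] := @sup_adherent _ E (i.+1%:R^-1); last by exists S.
  - by rewrite invr_gt0.
  - exact: supE.
have near_max i T : (S i `<=` T)%fset -> sqsum c T - sqsum c (S i) <= i.+1%:R^-1.
  move=> ST; have : sqsum c T <= sup E by apply: sup_upper_bound => //; exists T.
  by move=> TE; rewrite lerBlDr -lerBlDl (le_trans _ (ltW (HS i)))// lerB.
pose u i := finite_expansion c (S i).
have Hu i : H (u i) by exact: finite_expansion_in.
have [|f Hf uf] := hilbert_complete hH Hu.
  move=> d d0; have d4 : 0 < (d / 2) ^+ 2 by rewrite exprn_gt0// divr_gt0.
  have /seqlimP/(_ _ d4)[N HN] := @seqlim_harmonic R.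
  exists N => i j Ni Nj; pose w := finite_expansion c (S i `|` S j)%fset.
  have Hw : H w by exact: finite_expansion_in.
  have half k : (N <= k)%N -> (S k `<=` S i `|` S j)%fset ->
      hnorm H (fun x => w x - u k x) < d / 2.
    move=> Nk SU; rewrite -(@ltr_pXn2r _ 2)// ?nnegrE ?hnorm_ge0//; last by rewrite divr_ge0// ltW.
    rewrite hnorm_finite_expansionB//; apply: le_lt_trans (near_max _ _ SU) _.
    by have := HN k Nk; rewrite subr0 ger0_norm.
  have hi := half i Ni (fsubsetUl _ _); have hj := half j Nj (fsubsetUr _ _).
  have Hwi := hilbertB hH Hw (Hu i); have Hwj := hilbertB hH Hw (Hu j).
  have -> : (fun x => u i x - u j x) = (fun x => (-1) * (w x - u i x) + (w x - u j x)).
    by apply/funext => x; ring.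
  apply: le_lt_trans (hnormD hH (hilbertZ hH (-1) Hwi) Hwj) _.
  rewrite hnormZ// (_ : nrm (-1) = 1) ?mul1r; last by rewrite normrN1.
  by rewrite [d]splitr ltrD.
exists f, S; split => // v.
apply: seqlim_unique (hlim_inner hH Hu Hf (He v) uf) _.
apply/seqlim_nrmP => d d0; have d2 : 0 < d ^+ 2 by rewrite exprn_gt0.
have /seqlimP/(_ _ d2)[N HN] := @seqlim_harmonic R.
exists N => i Ni; rewrite inner_finite_expansion.
have [vS|vS] := boolP (v \in S i); first by rewrite mul1r subrr normr0.
rewrite mul0r sub0r (_ : nrm _ = nrm (c v)); last by rewrite normrN.
rewrite -(@ltr_pXn2r _ 2)// ?nnegrE ?nrm_ge0// ?ltW//.
have := near_max i (v |` S i)%fset (fsubsetU1 _ _).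
rewrite /sqsum big_fsetU1//= addrK => h.
by apply: le_lt_trans h _; have := HN i Ni; rewrite subr0 ger0_norm.
Qed.

Lemma inner_ext f g : H f -> H g ->
  (forall v, inner H f (e v) = inner H g (e v)) -> f = g.
Proof.
move=> Hf Hg fg; have /funeqP fg0 : (fun x => f x - g x) = fun=> 0.
  apply: complete_e => [|v]; first exact: hilbertB.
  by rewrite innerBl// fg subrr.
by apply/funext => x; apply/eqP; rewrite -subr_eq0; apply/eqP; exact: fg0.
Qed.

(** By completeness the limit built from the coefficients of [f] is [f]. *)
Lemma fourier_approx f : H f ->
  exists S : nat -> {fset V}, hlim H (fun i => finite_expansion (fun v => inner H f (e v)) (S i)) f.
Proof.
move=> Hf; have [g [S [Hg gf Sg]]] := riesz_fischer (fourier_ell2 Hf).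
have fg : f = g by apply: inner_ext => // v; rewrite gf.
by exists S; rewrite [X in hlim _ _ X]fg.
Qed.

(** The partial sums over [T] are the inner products with [g] of the expansions of
    [f] over [T], and the distance of these to [f] decreases with [T]; so one good
    finite set controls all larger ones. *)
Lemma parseval f g : H f -> H g ->
  inner (ell2 R V) (fun v => inner H f (e v)) (fun v => inner H g (e v)) = inner H f g.
Proof.
move=> Hf Hg; set c := fun v => inner H f (e v).
rewrite /=; apply: unconditional_sumE => d d0.
have dE : d = (complex.Re d)%:C by rewrite RRe_real// ger0_real// ltW.
set d' := complex.Re d in dE; have d'0 : 0 < d' by rewrite -ltcR -dE.
have [S Sf] := fourier_approx Hf.
have p0 : 0 < d' / (1 + hnorm H g) by rewrite divr_gt0// ltr_pwDl// hnorm_ge0.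
have /seqlimP/(_ _ p0)[N HN] := Sf.
exists (S N) => T ST.
have HT := finite_expansion_in c T; have HfT := hilbertB hH Hf HT.
have -> : \sum_(v <- T) (c v * (inner H g (e v))^* : R[i]^o) =
    inner H (finite_expansion c T) g.
  by rewrite inner_suml//; apply: eq_bigr => v _; rewrite (innerC hH Hg).
rewrite -innerBl// dE nrmlt; apply: le_lt_trans (cauchy_schwarz hH HfT Hg) _.
apply: (@le_lt_trans _ _ (hnorm H (fun x => f x - finite_expansion c (S N) x) * hnorm H g)).
  apply: ler_wpM2r; first exact: hnorm_ge0.
  rewrite -(@ler_pXn2r _ 2)// ?nnegrE ?hnorm_ge0//.
  by rewrite !hnorm_residual// lerD2l lerN2 sqsum_subset.
have := HN N (leqnn N); rewrite subr0.
have -> : (fun x => finite_expansion c (S N) x - f x) =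
    (fun x => (-1) * (f x - finite_expansion c (S N) x)) by apply/funext => x; ring.
rewrite (hnormZ hH); last by apply: (hilbertB hH) => //; exact: finite_expansion_in.
rewrite (_ : nrm (-1) = 1) ?mul1r; last by rewrite normrN1.
set r := hnorm H _; have r0 : 0 <= r by exact: hnorm_ge0.
rewrite ger0_norm//; have := hnorm_ge0 H g; set q := hnorm H g => q0.
by rewrite ltr_pdivlMr; nra.
Qed.

Lemma orthonormal_basis_unitary :
  unitary H (ell2 R V) (fun f v => inner H f (e v)).
Proof.
split=> [f Hf|a f g Hf Hg|f g Hf Hg|c Hc].
- exact: fourier_ell2.
- by apply/funext => v; rewrite inner_lin.
- exact: parseval.
- by have [f [S [Hf fc _]]] := riesz_fischer Hc; exists f => //; exact/funext.
Qed.

End orthonormal_basis.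

(** * Closed subspaces and multipliers *)

Section closed_subspace.
Variables (R : realType) (X : Type) (H : fspace R X) (K : X -> X -> R[i]).
Hypothesis hK : is_rkhs H K.

(** Norm limits are pointwise limits, so a linear condition that is stable under
    pointwise limits defines a closed subspace. *)
Lemma rkhs_subspace_hilbert (P : (X -> R[i]) -> Prop) :
  P (fun=> 0) ->
  (forall a f g, P f -> P g -> P (fun x => a * f x + g x)) ->
  (forall u f, (forall m, P (u m)) -> (forall x, seqlim (fun m => u m x) (f x)) -> P f) ->
  is_hilbert (FSpace [set f | H f /\ P f] (inner H)).
Proof.
move=> P0 Plin Plim; have hH := hK.1; split=> /=.
- split; first by split=> //; exact: hilbert0.
  by move=> a f g [Hf Pf] [Hg Pg]; split; [exact: hilbert_lin|exact: Plin].
- by move=> a f g h [Hf _] [Hg _] [Hh _]; exact: inner_lin.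
- by move=> f g [Hf _] [Hg _]; exact: innerC.
- by move=> f [Hf _]; split; [exact: inner_ge0|exact: inner_eq0].
- move=> u Hu cauchy_u; have Hu' m : H (u m) by case: (Hu m).
  have [f Hf uf] := hilbert_complete hH Hu' cauchy_u.
  exists f => //; split=> //; apply: Plim (fun m => (Hu m).2) _ => x.
  exact: (hlim_pointwise hK Hu' Hf uf).
Qed.

End closed_subspace.

Section multipliers.
Variables (R : realType) (X : Type) (H : fspace R X) (K : X -> X -> R[i]).
Hypothesis hK : is_rkhs H K.

Let hH : is_hilbert H := hK.1.

Definition multiplier (phi : X -> R[i]) : Prop :=
  exists2 M : R, 0 <= M & forall f, H f ->
    H (fun x => phi x * f x) /\ hnorm H (fun x => phi x * f x) <= M * hnorm H f.

Lemma multiplier_cst a : multiplier (fun=> a).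
Proof.
exists (nrm a) => [|f Hf]; first exact: nrm_ge0.
by split; [exact: hilbertZ|rewrite (hnormZ hH)].
Qed.

Lemma multiplierD phi psi :
  multiplier phi -> multiplier psi -> multiplier (fun x => phi x + psi x).
Proof.
move=> [M M0 HM] [N N0 HN]; exists (M + N) => [|f Hf]; first exact: addr_ge0.
have [h1 n1] := HM f Hf; have [h2 n2] := HN f Hf.
under eq_fun do rewrite mulrDl.
split; first exact: hilbertD.
by apply: (le_trans (hnormD hH h1 h2)); rewrite mulrDl lerD.
Qed.

Lemma multiplierM phi psi :
  multiplier phi -> multiplier psi -> multiplier (fun x => phi x * psi x).
Proof.
move=> [M M0 HM] [N N0 HN]; exists (M * N) => [|f Hf]; first exact: mulr_ge0.
have [h2 n2] := HN f Hf; have [h1 n1] := HM _ h2.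
under eq_fun do rewrite -mulrA.
split=> //; apply: (le_trans n1); rewrite -mulrA; exact: ler_wpM2l.
Qed.

Lemma multiplier_sum (I : Type) (s : seq I) (P : pred I) (phi : I -> X -> R[i]) :
  (forall i, multiplier (phi i)) -> multiplier (fun x => \sum_(i <- s | P i) phi i x).
Proof.
move=> h; elim: s => [|i s IH].
  by under eq_fun do rewrite big_nil; exact: multiplier_cst.
under eq_fun do rewrite big_cons.
by case: (P i) => //; exact: multiplierD.
Qed.

Lemma multiplier_prod (I : Type) (s : seq I) (P : pred I) (phi : I -> X -> R[i]) :
  (forall i, multiplier (phi i)) -> multiplier (fun x => \prod_(i <- s | P i) phi i x).
Proof.
move=> h; elim: s => [|i s IH].
  by under eq_fun do rewrite big_nil; exact: multiplier_cst.
under eq_fun do rewrite big_cons.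
by case: (P i) => //; exact: multiplierM.
Qed.

Section shift.
Variables (V : choiceType) (e : V -> X -> R[i]).
Hypothesis He : forall v, H (e v).
Hypothesis orthonormal_e : forall v w, inner H (e v) (e w) = (v == w)%:R.
Hypothesis complete_e : forall f, H f -> (forall v, inner H f (e v) = 0) -> f = fun=> 0.

(** A function that acts on an orthonormal basis as an injective shift with
    bounded weights is a multiplier: the bound holds on finite expansions because
    the shifted basis is again orthonormal, and it passes to norm limits since
    these are also pointwise limits. *)
Lemma weighted_shift_multiplier (phi : X -> R[i]) (s : V -> V) (wt : V -> R[i]) (M : R) :
  injective s -> 0 <= M -> (forall v, nrm (wt v) <= M) ->
  (forall v x, phi x * e v x = wt v * e (s v) x) ->
  multiplier phi.
Proof.
move=> s_inj M0 wtM phiE; exists M => // f Hf.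
pose c v := inner H f (e v).
have orth_s v w : inner H (e (s v)) (e (s w)) = (v == w)%:R.
  by rewrite orthonormal_e (inj_eq s_inj).
have phi_exp c' S : (fun x => phi x * finite_expansion e c' S x) =
    finite_expansion (fun v => e (s v)) (fun v => c' v * wt v) S.
  apply/funext => x; rewrite /finite_expansion mulr_sumr; apply: eq_bigr => v _.
  by rewrite mulrCA phiE mulrA.
have Hphi c' S : H (fun x => phi x * finite_expansion e c' S x).
  by rewrite phi_exp; exact: finite_expansion_in.
have phi_le c' S : hnorm H (fun x => phi x * finite_expansion e c' S x) <=
    M * hnorm H (finite_expansion e c' S).
  rewrite -(@ler_pXn2r _ 2)// ?nnegrE ?mulr_ge0 ?hnorm_ge0//.
  rewrite phi_exp exprMn !hnorm_finite_expansion// mulr_sumr; apply: ler_sum => v _.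
  rewrite nrmM exprMn mulrC ler_wpM2r ?sqr_ge0//.
  by rewrite ler_pXn2r// nnegrE// nrm_ge0.
have [S Sf] := fourier_approx hH He orthonormal_e complete_e Hf.
pose u i := finite_expansion e c (S i).
have Hu i : H (u i) by exact: finite_expansion_in.
(* Expansions over different sets are compared on their union, with the missing
   coefficients set to zero. *)
have widen (A B : {fset V}) : (A `<=` B)%fset ->
    finite_expansion e c A = finite_expansion e (fun v => (v \in A)%:R * c v) B.
  move=> /fsubsetP AB; apply/funext => x; rewrite /finite_expansion [RHS](bigID [in A])/=.
  rewrite [X in _ = _ + X]big1 ?addr0 => [|v /negbTE ->]; last by rewrite !mul0r.
  rewrite -[in RHS]big_filter; under [RHS]eq_big_seq => v.
    by rewrite mem_filter => /andP[-> _]; rewrite mul1r; over.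
  apply: perm_big; apply: uniq_perm => [||v].
  - exact: fset_uniq.
  - by rewrite filter_uniq.
  - by rewrite mem_filter andb_idr// => /AB.
have udiff i j : exists c' T, (fun x => u i x - u j x) = finite_expansion e c' T.
  exists (fun v => ((v \in S i)%:R - (v \in S j)%:R) * c v), (S i `|` S j)%fset.
  apply/funext => x; rewrite /u (widen _ _ (fsubsetUl (S i) (S j))).
  rewrite (widen _ _ (fsubsetUr (S i) (S j))) /finite_expansion -sumrB.
  by apply: eq_bigr => v _; rewrite !mulrBl.
have phi_diff i j : hnorm H (fun x => phi x * u i x - phi x * u j x) <=
    M * hnorm H (fun x => u i x - u j x).
  have [c' [T ijE]] := udiff i j; rewrite ijE; apply: le_trans (phi_le c' T).
  rewrite -ijE le_eqVlt; apply/orP; left; apply/eqP; congr (hnorm H _).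
  by apply/funext => x; rewrite mulrBr.
have [|g Hg phig] := hilbert_complete hH (fun i => Hphi c (S i)).
  move=> d d0; have d2 : 0 < d / 2 / (M + 1) by rewrite !divr_gt0// ltr_wpDl.
  have /seqlimP/(_ _ d2)[N HN] := Sf.
  exists N => i j /HN Ni /HN Nj; apply: le_lt_trans (phi_diff i j) _.
  have Hi := hilbertB hH (Hu i) Hf; have Hj := hilbertB hH (Hu j) Hf.
  have : hnorm H (fun x => u i x - u j x) <=
      hnorm H (fun x => u i x - f x) + hnorm H (fun x => u j x - f x).
    have -> : (fun x => u i x - u j x) = (fun x => (-1) * (u j x - f x) + (u i x - f x)).
      by apply/funext => x; ring.
    apply: (le_trans (hnormD hH (hilbertZ hH (-1) Hj) Hi)); rewrite hnormZ//.
    by rewrite (_ : nrm (-1) = 1) ?mul1r 1?addrC// normrN1.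
  move: Ni Nj; rewrite !subr0 !ger0_norm ?hnorm_ge0// => Ni Nj ij.
  have lt_d : hnorm H (fun x => u i x - u j x) < d / (M + 1).
    apply: (le_lt_trans ij); apply: (lt_le_trans (ltrD Ni Nj)).
    by rewrite -mulrDl -splitr.
  apply: (@le_lt_trans _ _ (M * (d / (M + 1)))); first by rewrite ler_wpM2l// ltW.
  by rewrite mulrA ltr_pdivrMr ?ltr_wpDl//; lra.
have gE : g = fun x => phi x * f x.
  apply/funext => x.
  apply: seqlim_unique (hlim_pointwise hK (fun i => Hphi c (S i)) Hg phig) _.
  by apply: seqlimZ; exact: (hlim_pointwise hK Hu Hf Sf).
rewrite -gE; split=> //.
apply: (hlim_hnorm_le (r := fun=> M * hnorm H f) hH (fun i => Hphi c (S i)) Hg phig).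
  move=> i; apply: (le_trans (phi_le _ _)); apply: ler_wpM2l => //.
  rewrite -(@ler_pXn2r _ 2)// ?nnegrE ?hnorm_ge0//.
  by rewrite hnorm_finite_expansion// bessel.
exact: seqlim_cst.
Qed.

End shift.
End multipliers.

(** * Monomials in the weighted Bergman space *)

Definition monomial (R : realType) (n : nat) (u : 'I_n -> nat) (z : 'rV[R[i]]_n) : R[i] :=
  \prod_j z 0 j ^+ u j.

Section bergman_space.
Variables (R : realType) (n : nat) (l : R).
Hypothesis l0 : 0 < l.
Variable A : fspace R (polydisc R n).
Hypothesis hA : is_rkhs A (@bergman_kernel R n l).
Implicit Types (u v : 'I_n -> nat) (z w : polydisc R n) (f : polydisc R n -> R[i]).

Let hH : is_hilbert A := hA.1.
Let K := @bergman_kernel R n l.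
Let A_K w : A (K ^~ w) := (hA.2 w).1.
Let reproducing f w : A f -> inner A f (K ^~ w) = f w.
Proof. by move=> Af; exact: (hA.2 w).2. Qed.

Definition on_polydisc (F : 'rV[R[i]]_n -> R[i]) : polydisc R n -> R[i] :=
  fun z => F (val z).

Local Notation mon u := (on_polydisc (monomial u)).

Lemma polydisc_coord z j : nrm ((val z) 0 j) < 1.
Proof. by have := set_mem (valP z) j; rewrite -nrmlt. Qed.

Lemma grid_point_subproof i (J : {ffun 'I_n -> 'I_(2 ^ i.+1)}) :
  (\row_j grid R i (J j)) \in polydisc R n.
Proof.
apply/mem_set => j; rewrite mxE -[1]/(1%:C) nrmlt nrm_grid.
by rewrite invf_lt1// ltr1n.
Qed.

Definition grid_point i (J : {ffun 'I_n -> 'I_(2 ^ i.+1)}) : polydisc R n := 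
  exist _ (\row_j grid R i (J j)) (@grid_point_subproof i J).

(** The product structure of the kernel turns this combination over the product
    grid into the product of the one-variable combinations. *)
Definition kernel_filter u i : polydisc R n -> R[i] :=
  fun z => \sum_(J : {ffun 'I_n -> 'I_(2 ^ i.+1)})
    (\prod_j twist R i (u j) (J j)) * K z (grid_point J).

Lemma kernel_filter_in u i : A (kernel_filter u i).
Proof. exact: (hilbert_sum hH). Qed.

Lemma kernel_filterE u i z :
  kernel_filter u i z = \prod_j filtered_kernel l i (u j) ((val z) 0 j).
Proof.
rewrite /filtered_kernel bigA_distr_bigA; apply: eq_bigr => J _.
rewrite /K /bergman_kernel -big_split; apply: eq_bigr => j _ /=.
by rewrite mxE.
Qed.

Lemma inner_kernel_filter u i f (phi : 'I_n -> R[i] -> R[i]) : A f ->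
  (forall z, f z = \prod_j phi j ((val z) 0 j)) ->
  inner A f (kernel_filter u i) =
  \prod_j \sum_(t < 2 ^ i.+1) (twist R i (u j) t)^* * phi j (grid R i t).
Proof.
move=> Af fE; rewrite (inner_sumr hH)// bigA_distr_bigA; apply: eq_bigr => J _.
rewrite reproducing// fE rmorph_prod -big_split; apply: eq_bigr => j _ /=.
by rewrite mxE.
Qed.

Let gram u i : R[i] := \prod_j filtered_kernel l i (u j) (2^-1)%:C.

Let inner_filters u i i' :
  inner A (kernel_filter u i') (kernel_filter u i) = gram u (maxn i i').
Proof.
rewrite (@inner_kernel_filter u i _ (fun j => filtered_kernel l i' (u j))
  (kernel_filter_in u i') (kernel_filterE u i')).
by apply: eq_bigr => j _; rewrite filtered_kernel_gram.
Qed.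

Let hnorm_filter_diff u i i' :
  hnorm A (fun z => kernel_filter u i z - kernel_filter u i' z) ^+ 2 =
  complex.Re (gram u i) + complex.Re (gram u i') - 2 * complex.Re (gram u (maxn i i')).
Proof.
have Hi := kernel_filter_in u i; have Hi' := kernel_filter_in u i'.
have HB := hilbertB hH Hi Hi'.
rewrite -[LHS]/(complex.Re ((_ ^+ 2)%:C)) hnorm_sqr// (innerBl hH)// !(innerBr hH)//.
rewrite !inner_filters !maxnn (maxnC i' i).
by case: (gram _ _) => a b; case: (gram _ _) => c d; case: (gram _ _) => p q /=; ring.
Qed.

(** The inverse of the squared norm of the monomial of exponent [u]. *)
Definition norm_const u : R := \prod_j nbc l (u j).

Lemma norm_const_gt0 u : 0 < norm_const u.
Proof. by apply: prodr_gt0 => j _; exact: nbc_gt0. Qed.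

(* The coefficient of the monomial in the limit of the filters; the powers of
   [1/2] come from the radius of the grid. *)
Let scale u : R[i] := (norm_const u)%:C * \prod_j (2^-1)%:C ^+ u j.

Let half_neq0 : (2^-1)%:C != 0 :> R[i].
Proof. by rewrite fmorph_eq0 invr_eq0 pnatr_eq0. Qed.

Let scale_neq0 u : scale u != 0.
Proof.
apply: mulf_neq0; first by rewrite fmorph_eq0 gt_eqF// norm_const_gt0.
by apply/prodf_neq0 => j _; rewrite expf_neq0.
Qed.

(* Since the Gram matrix at [(i, i')] depends only on the larger index, the squared
   distance of two filters is controlled by the convergence of its diagonal. *)
Let filter_limit u : A (fun z => scale u * mon u z) /\
  hlim A (kernel_filter u) (fun z => scale u * mon u z).
Proof.
have half1 : nrm ((2^-1)%:C : R[i]) < 1.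
  by rewrite nrm_real ger0_norm ?invr_ge0// invf_lt1// ltr1n.
have /seqlim_Re gram_lim := seqlim_prod (fun j : 'I_n => filtered_kernel_lim l0 (m := u j) half1).
set L := complex.Re _ in gram_lim.
have [|g Ag ug] := hilbert_complete hH (kernel_filter_in u).
  move=> e e0; have e4 : 0 < e ^+ 2 / 4 by rewrite divr_gt0// exprn_gt0.
  have /seqlimP/(_ _ e4)[N HN] := gram_lim; exists N => i i' Ni Ni'.
  rewrite -(@ltr_pXn2r _ 2)// ?nnegrE ?hnorm_ge0// ?ltW// hnorm_filter_diff.
  have := HN _ Ni; have := HN _ Ni'; have := HN (maxn i i') (leq_trans Ni (leq_maxl _ _)).
  rewrite !ltr_norml /gram; lra.
suff -> : (fun z => scale u * mon u z) = g by [].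
apply/funext => z; apply: seqlim_unique (hlim_pointwise hA (kernel_filter_in u) Ag ug).
have := seqlim_prod (fun j : 'I_n => filtered_kernel_lim l0 (m := u j) (polydisc_coord z j)).
rewrite (_ : \prod_j _ = scale u * mon u z).
  by apply: eq_seqlim => i; rewrite kernel_filterE.
rewrite /scale /norm_const /on_polydisc /monomial rmorph_prod -!big_split.
apply: eq_bigr => j _ /=; rewrite exprMn -mulrA; congr (_ * _).
by rewrite mulrC fmorphV/= rmorph_nat.
Qed.

Lemma monomial_in u : A (mon u).
Proof.
have := hilbertZ hH (scale u)^-1 (filter_limit u).1.
by congr (carrier A _); apply/funext => z; rewrite mulKf// scale_neq0.
Qed.

(** Pairing a monomial with a filter averages it over the grid, which gives zero
    or one as soon as the grid separates the exponents. *)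
Lemma inner_monomial u v : inner A (mon v) (mon u) =
  [forall j, v j == u j]%:R / (norm_const u)%:C.
Proof.
have [Ag ug] := filter_limit u; have Av := monomial_in v.
have h1 := hlim_inner hH (kernel_filter_in u) Ag Av ug.
have -> : inner A (mon v) (mon u) = (inner A (fun z => scale u * mon u z) (mon v) / scale u)^*.
  rewrite (innerZl hH)//; last exact: monomial_in.
  rewrite mulrAC divff ?scale_neq0// mul1r; apply: (innerC hH) => //; exact: monomial_in.
pose D := (\prod_j (2^-1)%:C ^+ v j * [forall j, v j == u j]%:R : R[i]).
have -> : inner A (fun z => scale u * mon u z) (mon v) = D^*.
  apply: seqlim_unique h1 _; apply/seqlim_nrmP => e e0.
  (* From this rank on, congruent exponents are equal. *)
  exists (\sum_j (u j + v j))%N => i large.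
  rewrite (innerC hH Av (kernel_filter_in u i)).
  rewrite (inner_kernel_filter u i (phi := fun j x => x ^+ v j) Av)//.
  rewrite (_ : \prod_j _ = D) ?subrr ?normr0//.
  under eq_bigr do rewrite grid_average; rewrite big_split; congr (_ * _).
  have small j : (u j < 2 ^ i.+1)%N /\ (v j < 2 ^ i.+1)%N.
    have : (u j + v j <= \sum_j (u j + v j))%N by rewrite (bigD1 j)//= leq_addr.
    move=> /leq_trans/(_ large) h; have h2 := ltn_trans (ltnSn i) (ltn_expl i.+1 (ltnSn 1)).
    split; apply: leq_ltn_trans h2; apply: leq_trans h; rewrite ?leq_addr ?leq_addl//.
  have [/forallP uv|/forallPn[j uvj]] := boolP [forall j, v j == u j].
    by rewrite big1// => j _; rewrite (eqP (uv j)) eqxx.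
  apply/eqP; rewrite prodf_seq_eq0; apply/hasP; exists j; rewrite ?mem_index_enum//=.
  have [? ?] := small j; rewrite !modn_small// (negbTE uvj)//.
have scaleC : (scale u)^* = scale u.
  rewrite (_ : scale u = (norm_const u * \prod_j 2^-1 ^+ u j)%:C) ?conj_real_complex//.
  rewrite rmorphM/=; congr (_ * _); rewrite rmorph_prod.
  by apply: eq_bigr => j _; rewrite rmorphXn.
rewrite fmorph_div/= conjCK scaleC /D /scale.
have [/forallP uv|_] := boolP [forall j, v j == u j]; last by rewrite mulr0 !mul0r.
have -> : v = u by apply/funext => j; exact/eqP.
rewrite mulr1 mul1r invfM mulrCA divff ?mulr1//.
by apply/prodf_neq0 => j _; rewrite expf_neq0.
Qed.

(** Truncation of the kernel at [w], as a function of its first variable, to a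
    box of exponents. *)
Definition kernel_truncation w N : polydisc R n -> R[i] :=
  fun z => \sum_(U : {ffun 'I_n -> 'I_N})
    (\prod_j ((nbc l (U j))%:C * ((val w) 0 j)^* ^+ U j)) * mon (fun j => U j : nat) z.

Lemma kernel_truncation_in w N : A (kernel_truncation w N).
Proof. by apply: (hilbert_sum hH) => U; exact: monomial_in. Qed.

Lemma kernel_truncationE w N z : kernel_truncation w N z =
  \prod_j \sum_(k < N) (nbc l k)%:C * (((val z) 0 j) ^+ k * ((val w) 0 j)^* ^+ k).
Proof.
rewrite bigA_distr_bigA; apply: eq_bigr => U _.
rewrite /on_polydisc /monomial -big_split; apply: eq_bigr => j _ /=; ring.
Qed.

Let truncation_lim w : seqlim (fun N => kernel_truncation w N w) (K w w).
Proof.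
have := seqlim_prod (fun j : 'I_n => power_kernel_series l0 (polydisc_coord w j) (polydisc_coord w j)).
by apply: eq_seqlim => N; rewrite kernel_truncationE.
Qed.

Let inner_truncation w N :
  inner A (kernel_truncation w N) (kernel_truncation w N) = kernel_truncation w N w.
Proof.
rewrite {1}/kernel_truncation (inner_suml hH)//; last first.
- exact: kernel_truncation_in.
- by move=> U; exact: monomial_in.
apply: eq_bigr => U _; congr (_ * _).
rewrite (inner_sumr hH)//; last first.
- exact: monomial_in.
- by move=> V; exact: monomial_in.
rewrite (bigD1 U)//= [X in _ + X]big1 ?addr0 => [|V VU]; last first.
  rewrite inner_monomial (_ : [forall j, _] = false) ?mul0r ?mulr0//.
  by apply: contraNF VU => /forallP UV; apply/eqP/ffunP => j; apply/val_inj/eqP; rewrite eq_sym; exact: UV.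
rewrite inner_monomial (_ : [forall j, _]); last by apply/forallP => j.
rewrite div1r rmorph_prod; under eq_bigr do rewrite rmorphM/= conj_real_complex rmorphXn/= conjCK.
rewrite big_split/= -rmorph_prod -/(norm_const _) mulrAC divff ?mul1r//.
by rewrite fmorph_eq0 gt_eqF// norm_const_gt0.
Qed.

(** Orthogonality of the monomials gives the truncation the squared norm
    [kernel_truncation w N w], so its squared distance to the kernel is
    [K w w - kernel_truncation w N w]. *)
Lemma kernel_truncation_hlim w : hlim A (kernel_truncation w) (K ^~ w).
Proof.
have E N : ((hnorm A (fun z => kernel_truncation w N z - K z w)) ^+ 2)%:C =
    K w w - kernel_truncation w N w.
  have AT := kernel_truncation_in w N; have AB := hilbertB hH AT (A_K w).
  rewrite hnorm_sqr// (innerBl hH)// !(innerBr hH)// inner_truncation !reproducing//.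
  by rewrite (innerC hH AT (A_K w)) reproducing// -inner_truncation -(innerC hH AT AT); ring.
apply/seqlimP => e e0; have e2 : 0 < e ^+ 2 by rewrite exprn_gt0.
have /seqlim_nrmP/(_ _ e2)[N HN] := @truncation_lim w.
exists N => m /HN small; rewrite subr0 ger0_norm ?hnorm_ge0//.
rewrite -(@ltr_pXn2r _ 2)// ?nnegrE ?hnorm_ge0// ?(ltW e0)//; apply: le_lt_trans small.
have -> : kernel_truncation w m w - K w w =
    - (hnorm A (fun z => kernel_truncation w m z - K z w) ^+ 2)%:C by rewrite E opprB.
by rewrite normrN nrm_real ger0_norm// sqr_ge0.
Qed.

Lemma kernel_truncation_lim w f : A f ->
  seqlim (fun N => inner A (kernel_truncation w N) f) (f w)^*.
Proof.
move=> Af; rewrite -reproducing// -(innerC hH Af (A_K w)).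
exact: (hlim_inner hH (kernel_truncation_in w) (A_K w) Af (@kernel_truncation_hlim w)).
Qed.

Lemma monomials_complete f : A f -> (forall u, inner A f (mon u) = 0) -> f = fun=> 0.
Proof.
move=> Af f0; apply/funext => w; apply/eqP; rewrite -conjC_eq0; apply/eqP.
apply: seqlim_unique (kernel_truncation_lim Af) _.
apply: eq_seqlim (@seqlim_cst _ 0) => N.
rewrite (inner_suml hH)//; last by move=> U; exact: monomial_in.
rewrite big1// => U _; rewrite (innerC hH Af); last exact: monomial_in.
by rewrite f0 conjC0 mulr0.
Qed.

Definition normalized_monomial (v : {ffun 'I_n -> nat}) : polydisc R n -> R[i] :=
  fun z => (Num.sqrt (norm_const v))%:C * mon v z.

Let sqrt_norm_const u : (Num.sqrt (norm_const u))%:C * (Num.sqrt (norm_const u))%:C = (norm_const u)%:C.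
Proof. by rewrite -rmorphM/= -expr2 sqr_sqrtr// ltW// norm_const_gt0. Qed.

Lemma normalized_monomial_in (v : {ffun 'I_n -> nat}) : A (normalized_monomial v).
Proof. by apply: (hilbertZ hH); exact: monomial_in. Qed.

Lemma normalized_monomial_orthonormal (v w : {ffun 'I_n -> nat}) :
  inner A (normalized_monomial v) (normalized_monomial w) = (v == w)%:R.
Proof.
have [Av Aw] := (monomial_in v, monomial_in w).
rewrite (innerZl hH)//; last exact: normalized_monomial_in.
rewrite (innerZr hH)// conj_real_complex inner_monomial.
have -> : [forall j, v j == w j] = (v == w).
  by apply/forallP/eqP => [vw|-> //]; apply/ffunP => j; exact/eqP.
have [->|_] := eqVneq v w; last by rewrite mul0r !mulr0.
by rewrite mul1r mulrA sqrt_norm_const divff// fmorph_eq0 gt_eqF// norm_const_gt0.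
Qed.

Lemma normalized_monomial_complete f : A f ->
  (forall v : {ffun 'I_n -> nat}, inner A f (normalized_monomial v) = 0) -> f = fun=> 0.
Proof.
move=> Af f0; apply: monomials_complete => // u; have := f0 [ffun j => u j].
rewrite (innerZr hH)//; last exact: monomial_in.
have -> : mon [ffun j => u j] = mon u.
  by apply/funext => z; apply: eq_bigr => j _; rewrite ffunE.
move=> /eqP; rewrite mulf_eq0 conj_real_complex fmorph_eq0 gt_eqF/=; first by move/eqP.
by rewrite sqrtr_gt0 norm_const_gt0.
Qed.

(** The squared weight at [v] is [(v_j + 1) / (l + v_j)], at most [1 + 1 / l]. *)
Lemma coordinate_multiplier j : multiplier A (fun z => (val z) 0 j).
Proof.
pose s (v : {ffun 'I_n -> nat}) := [ffun i => (v i + (i == j))%N].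
have s_inj : injective s.
  by move=> v w /ffunP vw; apply/ffunP => i; have := vw i; rewrite !ffunE => /addIn.
pose M := Num.sqrt (1 + l^-1).
have sE (v : {ffun 'I_n -> nat}) : norm_const (s v) = norm_const v * ((l + (v j)%:R) / (v j).+1%:R).
  rewrite /norm_const (bigD1 j)//= [in RHS](bigD1 j)//= !ffunE eqxx addn1 nbcS.
  rewrite mulrAC; congr (_ * _ * _); apply: eq_bigr => i /negbTE ij.
  by rewrite ffunE ij addn0.
apply: (weighted_shift_multiplier hA normalized_monomial_in normalized_monomial_orthonormal
  normalized_monomial_complete s_inj (M := M)
  (wt := fun v : {ffun 'I_n -> nat} => (Num.sqrt (norm_const v) / Num.sqrt (norm_const (s v)))%:C)).
- exact: sqrtr_ge0.
- move=> v; rewrite nrm_real ger0_norm ?divr_ge0 ?sqrtr_ge0// ler_pdivrMr; last first.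
    by rewrite sqrtr_gt0 norm_const_gt0.
  rewrite -sqrtrM ?addr_ge0 ?invr_ge0 ?(ltW l0)//; apply: ler_wsqrtr.
  rewrite sE mulrCA -[leLHS]mulr1 ler_wpM2l// ?(ltW (norm_const_gt0 _))//.
  rewrite mulrA ler_pdivlMr// mul1r mulrDl mul1r -natr1 mulrDr mulVf ?gt_eqF//.
  have : 0 <= l^-1 * (v j)%:R by rewrite mulr_ge0 ?invr_ge0// ltW.
  by have := l0; lra.
- move=> v z; rewrite /normalized_monomial rmorphM/= fmorphV/= -!mulrA mulrCA; congr (_ * _).
  rewrite mulKf ?fmorph_eq0 ?gt_eqF ?sqrtr_gt0 ?norm_const_gt0//.
  rewrite /on_polydisc /monomial (bigD1 j)//= [in RHS](bigD1 j)//= !ffunE eqxx addn1 exprS mulrA.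
  by congr (_ * _); apply: eq_bigr => i /negbTE ij; rewrite ffunE ij addn0.
Qed.

Lemma elem_sym_multiplier k : multiplier A (fun z => elem_sym k (val z)).
Proof.
apply: multiplier_sum => //; first exact: hA.
move=> S; apply: (multiplier_prod hA) => j.
exact: coordinate_multiplier.
Qed.

End bergman_space.

(** * Weighted shifts from orthogonal bases *)

Lemma indic_set1 (R : realType) (V : choiceType) (u v : V) :
  \1_[set u] v = (u == v)%:R :> R[i].
Proof.
by rewrite indicE; congr (_%:R); congr nat_of_bool; apply/idP/eqP; rewrite inE.
Qed.

Section shift_model.
Variables (R : realType) (X : Type) (H : fspace R X).
Hypothesis hH : is_hilbert H.
Variables (V : choiceType) (b : V -> X -> R[i]).
Hypothesis Hb : forall v, H (b v).
Hypothesis orthogonal_b : forall u v, u != v -> inner H (b u) (b v) = 0.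
Hypothesis b_neq0 : forall v, hnorm H (b v) != 0.
Hypothesis complete_b : forall f, H f -> (forall v, inner H f (b v) = 0) -> f = fun=> 0.
Variables (n : nat) (T : 'I_n -> (X -> R[i]) -> (X -> R[i])).
Hypothesis bounded_T : forall k, bounded_operator H (T k).
Variables (E : 'I_n -> V -> V -> Prop) (c : 'I_n -> V -> V -> R).
Hypothesis finite_Chi : forall k u, finite_set (Chi (E k) u).
Hypothesis TE : forall k u x,
  T k (b u) x = \sum_(v \in Chi (E k) u) (c k u v)%:C * b v x.

Let e v : X -> R[i] := fun x => (hnorm H (b v))^-1%:C * b v x.

Let He v : H (e v). Proof. exact: hilbertZ. Qed.

Let inner_b_e u v : inner H (b u) (e v) = (u == v)%:R * (hnorm H (b v))%:C.
Proof.
rewrite (innerZr hH)// conj_real_complex; have [->|uv] := eqVneq u v; last first.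
  by rewrite orthogonal_b// mulr0 mul0r.
rewrite -hnorm_sqr// -rmorphM/= mul1r expr2 mulKf//.
Qed.

Let orthonormal_e u v : inner H (e u) (e v) = (u == v)%:R.
Proof.
rewrite (innerZl hH)// inner_b_e mulrCA; have [->|_] := eqVneq u v; last by rewrite mul0r.
by rewrite mul1r -rmorphM/= mulVf.
Qed.

Let complete_e f : H f -> (forall v, inner H f (e v) = 0) -> f = fun=> 0.
Proof.
move=> Hf f0; apply: complete_b => // v; have := f0 v.
rewrite (innerZr hH)// => /eqP; rewrite mulf_eq0 conj_real_complex fmorph_eq0.
by rewrite invr_eq0 (negbTE (b_neq0 v))/= => /eqP.
Qed.

Let U f : V -> R[i] := fun v => inner H f (e v).

Let unitary_U : unitary H (ell2 R V) U.
Proof. exact: orthonormal_basis_unitary. Qed.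

Let U_inj f g : H f -> H g -> U f = U g -> f = g.
Proof.
move=> Hf Hg UE; apply: (inner_ext hH He complete_e) => // v.
exact: (congr1 (fun h => h v) UE).
Qed.

Let hnorm_U f : H f -> hnorm (ell2 R V) (U f) = hnorm H f.
Proof. by move=> Hf; case: unitary_U => _ _ UU _; rewrite /hnorm UU. Qed.

Let T0 k : T k (fun=> 0) = fun=> 0.
Proof.
have [_ Tlin _] := bounded_T k.
have E0 : (fun _ : X => 1 * 0 + 0) = (fun _ => 0) :> (X -> R[i]).
  by apply/funext => y; rewrite mulr0 addr0.
have := Tlin 1 _ _ (hilbert0 hH) (hilbert0 hH); rewrite E0 => /funeqP T00.
apply/funext => x; have := T00 x.
by rewrite mul1r => /eqP; rewrite -subr_eq0 opprD addrA subrr sub0r oppr_eq0 => /eqP.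
Qed.

Let Te k u x : T k (e u) x = (hnorm H (b u))^-1%:C * T k (b u) x.
Proof.
have [_ Tlin _] := bounded_T k.
have /funeqP/(_ x) := Tlin (hnorm H (b u))^-1%:C _ _ (Hb u) (hilbert0 hH).
by rewrite T0 addr0 => <-; congr (T k _ x); apply/funext => y; rewrite addr0.
Qed.

(** Transporting the operators along the unitary that maps the normalized family
    to the canonical basis turns them into weighted shifts. *)
Lemma weighted_shift_model : exists L : 'I_n -> (V -> R[i]) -> (V -> R[i]),
  (forall k, is_weighted_shift (E k)
     (fun u v => (c k u v * (hnorm H (b v) / hnorm H (b u)))%:C) (L k)) /\
  unitarily_equivalent H (ell2 R V) T L.
Proof.
have [U_ell2 U_lin U_inner U_surj] := unitary_U.
(* [W] is the inverse of [U], extended by zero outside the square-summable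
   families. *)
have /choice[W HW] : forall g, exists f, ell2 R V g -> H f /\ U f = g.
  move=> g; have [hg|?] := pselect (ell2 R V g); last by exists (fun=> 0).
  by have [f Hf <-] := U_surj _ hg; exists f.
have WU f : H f -> W (U f) = f.
  by move=> Hf; have [HWf UW] := HW _ (U_ell2 f Hf); exact: U_inj.
pose L k g := U (T k (W g)).
have bounded_L k : bounded_operator (ell2 R V) (L k).
  have [HT Tlin [M HM]] := bounded_T k; split=> [g hg|a f g hf hg|].
  - by apply: U_ell2; apply: HT; exact: (HW g hg).1.
  - have [Hf Uf] := HW f hf; have [Hg Ug] := HW g hg.
    rewrite /L -{1}Uf -{1}Ug -U_lin// WU; last exact: hilbert_lin.
    by rewrite Tlin// U_lin//; exact: HT.
  - exists M => g hg; have [Hg Ug] := HW g hg.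
    by rewrite /L -[in leRHS]Ug !hnorm_U//; [exact: HM|exact: HT].
exists L; split=> [k|]; last first.
  split=> //; exists U; first exact: unitary_U.
  by move=> k f Hf; rewrite /L WU.
split=> // u; have -> : \1_[set u] = U (e u) :> (V -> R[i]).
  by apply/funext => v; rewrite /U orthonormal_e indic_set1.
rewrite /L WU//; apply/funext => x; rewrite /U.
have -> : T k (e u) = fun x => \sum_(v <- fset_set (Chi (E k) u))
    ((hnorm H (b u))^-1%:C * (c k u v)%:C) * b v x.
  apply/funext => y; rewrite Te TE fsbig_finite//= mulr_sumr.
  by apply: eq_bigr => v _; rewrite mulrA.
rewrite (inner_suml hH)// fsbig_finite//=; apply: eq_bigr => v _.
rewrite inner_b_e indic_set1.
have [->|_] := eqVneq v x; last by rewrite mul0r !mulr0.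
by rewrite mul1r mulr1 -!rmorphM/=; congr (_%:C); ring.
Qed.

End shift_model.

(** * The graphs of unit raises *)

Section box_graphs.
Variable n : nat.
Implicit Types (u v : n.-tuple nat) (S : {set 'I_n}).

Definition raise (u : 'I_n -> nat) S : 'I_n -> nat := fun j => (u j + (j \in S))%N.

Definition raised_set u v : {set 'I_n} := [set j | tnth v j == (tnth u j).+1].

Lemma sum_mem S : (\sum_(j < n) (j \in S) = #|S|)%N.
Proof. by rewrite -sum1_card [RHS]big_mkcond; apply: eq_bigr => j _; case: (j \in S). Qed.

Lemma sum_raise u v S : tnth v =1 raise (tnth u) S ->
  \sum_(j < n) ((tnth v j)%:Z - (tnth u j)%:Z) = #|S|%:Z.
Proof.
move=> vE; rewrite -sum_mem (big_morph Posz PoszD (erefl _)).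
by apply: eq_bigr => j _; rewrite vE /raise PoszD addrAC subrr add0r.
Qed.

(** An edge is the choice of the set of positions that are raised by one. *)
Lemma IsetP k u v : Iset k u v <->
  [/\ Qn n v, #|raised_set u v| = k & tnth v =1 raise (tnth u) (raised_set u v)].
Proof.
split=> [[vQ sumk step]|[vQ cardk vE]].
  have vE : tnth v =1 raise (tnth u) (raised_set u v).
    move=> j; have := step j; rewrite /raise inE.
    by have [->|] := eqVneq (tnth v j) (tnth u j).+1; lia.
  by split=> //; move: sumk; rewrite (sum_raise vE) => -[].
split=> // [|j]; first by rewrite (sum_raise vE) cardk.
by rewrite vE /raise; lia.
Qed.

Lemma raised_set_raise u v S : tnth v =1 raise (tnth u) S -> raised_set u v = S.
Proof. by move=> vE; apply/setP => j; rewrite inE vE /raise; case: (j \in S); lia. Qed.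

Variables (W : set (n.-tuple nat)) (k : nat).

Let E (u v : W) : Prop := Iset k.+1 (val u) (val v).

Let raised_inj u v w : Iset k.+1 u v -> Iset k.+1 u w ->
  raised_set u v = raised_set u w -> v = w.
Proof.
move=> /IsetP[_ _ vE] /IsetP[_ _ wE] vw; apply: eq_from_tnth => j.
by rewrite vE wE vw.
Qed.

Lemma Chi_box_card (u : W) : (Chi E u #<= `I_#|{set 'I_n}|)%card.
Proof.
pose f (v : W) : nat := enum_rank (raised_set (val u) (val v)).
have f_inj : {in Chi E u &, injective f}.
  move=> v w; rewrite !inE => uv uw /val_inj/enum_rank_inj vw.
  by apply: val_inj; exact: raised_inj uv uw vw.
rewrite -(card_le_eql (inj_card_eq f_inj)); apply: subset_card_le.
by move=> _ [v _ <-]; exact: ltn_ord.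
Qed.

Lemma Chi_box_finite (u : W) : finite_set (Chi E u).
Proof. by apply/finite_set_leP; exists #|{set 'I_n}|; exact: Chi_box_card. Qed.

Let level u := (\sum_(j < n) tnth u j)%N.

Let level_lt (u v : W) : E u v -> (level (val u) < level (val v))%N.
Proof.
move=> /IsetP[_ cardk vE]; rewrite /level.
under [X in (_ < X)%N]eq_bigr do rewrite vE.
by rewrite big_split/= sum_mem cardk addnS ltnS leq_addr.
Qed.

(** Every edge raises the sum of the entries, which rules out circuits; only
    finitely many raises are possible from a vertex, whence the bound. *)
Lemma box_graph_semi_tree : generalized_directed_semi_tree E.
Proof.
split.
- case=> [//|u p] _ _ /= cyc.
  have lt_level : {homo (fun v : W => level (val v)) : v w / `[< E v w >] >-> (v < w)%N}.
    by move=> v w /asboolP; exact: level_lt.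
  have := order_path_min ltn_trans (homo_path lt_level cyc).
  by rewrite map_rcons all_rcons ltnn.
- apply: (@sub_countable _ _ _ [set: W]); last first.
    apply/countable_injP; exists (fun v : W => choice.pickle (val v)).
    by move=> v w _ _ /(pcan_inj choice.pickleK)/val_inj.
  rewrite (_ : components E = (fun u : W => [set v | connected_vertices E u v]) @` [set: W]).
    exact: card_image_le.
  by apply/seteqP; split=> [_ [u ->]|_ [u _ <-]]; exists u.
- exists #|{set 'I_n}| => u v _.
  by apply: card_le_trans (Chi_box_card u); apply: subset_card_le => w [].
Qed.

Lemma box_graph_least_bound : exists m, least_common_children_bound E m.
Proof.
have [_ _ [m0 bm0]] := box_graph_semi_tree.
have ex : exists m, `[< common_children_bound E m >] by exists m0; exact/asboolP.
exists (ex_minn ex); case: ex_minnP => m /asboolP bm min_m.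
by split=> // m' /asboolP; exact: min_m.
Qed.

End box_graphs.

(** * Decreasing rearrangements *)

Section rearrangement.
Variable n : nat.
Implicit Types (u v : 'I_n -> nat).

Definition decreasing_rearrangement u : n.-tuple nat := sort_tuple geq (mktuple u).

Lemma rearrangement_sorted u : Qn n (decreasing_rearrangement u).
Proof. by apply: sort_sorted => a b; exact: leq_total. Qed.

Lemma rearrangementP u : exists p : 'S_n, forall j, u j = tnth (decreasing_rearrangement u) (p j).
Proof.
have : perm_eq (mktuple u) (decreasing_rearrangement u) by rewrite perm_sym perm_sort.
case/tuple_permP => p E; exists p => j.
have /val_inj/(congr1 (fun t => tnth t j)) : val (mktuple u) = val [tuple tnth (decreasing_rearrangement u) (p i) | i < n] by [].
by rewrite !tnth_mktuple.
Qed.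

Let geq_trans : transitive geq.
Proof. by move=> a b c ab /leq_trans; apply. Qed.

Let geq_anti : antisymmetric geq.
Proof. by move=> a b h; apply: anti_leq; rewrite andbC. Qed.

(** A multiset has only one decreasing arrangement. *)
Lemma Qn_perm_inj (u v : n.-tuple nat) (p : 'S_n) : Qn n u -> Qn n v ->
  (forall j, tnth u j = tnth v (p j)) -> u = v.
Proof.
move=> uQ vQ uv; apply/val_inj/(sorted_eq geq_trans geq_anti uQ vQ)/tuple_permP.
exists p; congr val; apply: eq_from_tnth => j; by rewrite tnth_mktuple.
Qed.

Lemma rearrangement_id (u : n.-tuple nat) : Qn n u -> decreasing_rearrangement (tnth u) = u.
Proof.
move=> uQ; have [p up] := rearrangementP (tnth u).
exact/esym/(Qn_perm_inj uQ (rearrangement_sorted _) up).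
Qed.

Let count_sorted (s : seq nat) i a : sorted geq s -> (0 < a)%N ->
  (i < count (leq a) s)%N = (a <= nth 0 s i)%N.
Proof.
elim: s i => [|x s IH] i; first by move=> _ a0; rewrite nth_nil leqn0 gtn_eqF.
move=> /= xs a0; have ss := path_sorted xs.
have allx : all (geq x) s by exact: (order_path_min geq_trans xs).
have [ax|xa] := leqP a x.
  by case: i => [|i] /=; [rewrite ax|rewrite add1n ltnS IH].
rewrite add0n (_ : count (leq a) s = 0%N).
  case: i => [|i] /=; first by rewrite [in RHS]leqNgt xa.
  apply/esym/negbTE; rewrite -ltnNge.
  have [si|si] := ltnP i (size s); last by rewrite nth_default.
  by apply: leq_ltn_trans xa; exact: (allP allx _ (mem_nth 0 si)).
apply/eqP; rewrite -leqn0 leqNgt -has_count; apply/hasPn => y ys.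
by rewrite -ltnNge; apply: leq_ltn_trans xa; exact: (allP allx _ ys).
Qed.

(** The [i]-th largest entry is determined by the counts of entries above each
    threshold, and these are monotone. *)
Lemma rearrangement_le u v : (forall j, u j <= v j)%N ->
  forall j, (tnth (decreasing_rearrangement u) j <= tnth (decreasing_rearrangement v) j)%N.
Proof.
move=> uv j; set a := tnth _ j; have [-> //|a0] := posnP a.
have nthE (t : n.-tuple nat) : tnth t j = nth 0 t j by exact: tnth_nth.
rewrite nthE -count_sorted//; last exact: rearrangement_sorted.
have : (j < count (leq a) (decreasing_rearrangement u))%N.
  by rewrite count_sorted// -?nthE//; exact: rearrangement_sorted.
move=> /leq_trans; apply.
have countE w : count (leq a) (decreasing_rearrangement w) = count (fun i => a <= w i)%N (enum 'I_n).
  have /seq.permP -> : perm_eq (decreasing_rearrangement w) (mktuple w) by rewrite perm_sort.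
  by rewrite /= count_map.
rewrite !countE; apply: sub_count => i /= ai; exact: leq_trans (uv i).
Qed.

(** Rearranging is monotone and [u <= raise u S <= u + 1], so the rearrangement
    still lies between [u] and [u + 1]. *)
Lemma raise_rearrangement (u : n.-tuple nat) (S : {set 'I_n}) k : Qn n u -> #|S| = k ->
  Iset k u (decreasing_rearrangement (raise (tnth u) S)).
Proof.
move=> uQ Sk; set v := decreasing_rearrangement _.
have lo j : (tnth u j <= tnth v j)%N.
  rewrite -{1}(rearrangement_id uQ); apply: rearrangement_le => i.
  by rewrite leq_addr.
have hi j : (tnth v j <= (tnth u j).+1)%N.
  pose u' : n.-tuple nat := mktuple (fun i => (tnth u i).+1).
  have u'Q : Qn n u'.
    have uE : tval u' = map succn u.
      rewrite -[in RHS](map_tnth_enum u) -map_comp; exact: eq_map.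
    change (is_true (sorted geq (tval u'))); rewrite uE sorted_map.
    by apply: sub_sorted uQ => a b; rewrite /= ltnS.
  have -> : (tnth u j).+1 = tnth (decreasing_rearrangement (tnth u')) j.
    by rewrite rearrangement_id// tnth_mktuple.
  apply: rearrangement_le => i; rewrite tnth_mktuple /raise.
  by case: (i \in S); rewrite ?addn1 ?addn0.
have vE : tnth v =1 raise (tnth u) (raised_set u v).
  move=> j; rewrite /raise inE; have := lo j; have := hi j.
  by have [->|] := eqVneq (tnth v j) (tnth u j).+1; lia.
apply/IsetP; split=> //; first exact: rearrangement_sorted.
have [p vp] := rearrangementP (raise (tnth u) S).
(* The sum of the entries is invariant under rearrangement. *)
have : (\sum_(j < n) raise (tnth u) S j = \sum_(j < n) raise (tnth u) (raised_set u v) j)%N.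
  rewrite (eq_bigr _ (fun j _ => vp j)) [LHS](reindex_inj (@perm_inj _ p^-1%g)) /=.
  by apply: eq_bigr => j _; rewrite permKV vE.
rewrite /raise !big_split/= !sum_mem => /addnI <-; exact: Sk.
Qed.

Lemma Iset_rearrangement k (u v : n.-tuple nat) : Iset k u v ->
  decreasing_rearrangement (raise (tnth u) (raised_set u v)) = v.
Proof.
move=> /IsetP[vQ _ vE]; rewrite -[RHS](rearrangement_id vQ).
by congr decreasing_rearrangement; apply/funext.
Qed.

Lemma sorted_tuple_le (u : n.-tuple nat) : Qn n u <->
  forall i j : 'I_n, (i <= j)%N -> (tnth u j <= tnth u i)%N.
Proof.
split=> [uQ i j ij|h].
  rewrite !(tnth_nth 0); apply: (sorted_leq_nth geq_trans leqnn 0 uQ) => //;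
  by rewrite inE size_tuple.
apply/(sortedP 0) => i; rewrite size_tuple => i1.
have i0 : (i < n)%N by exact: ltnW.
by have := h (Ordinal i0) (Ordinal i1) (leqnSn i); rewrite !(tnth_nth 0).
Qed.

(** For the converse, [v_j = u_j - (n - 1 - j)] is decreasing and nonnegative
    because a strictly decreasing sequence of integers falls by at least [d] over
    [d] steps. *)
Lemma PantiP (u : n.-tuple nat) : Panti n u <->
  forall i j : 'I_n, (i < j)%N -> (tnth u j < tnth u i)%N.
Proof.
split=> [[v /sorted_tuple_le vQ ->] i j ij|h].
  rewrite !tnth_mktuple; have := vQ i j (ltnW ij); have := ltn_ord j; lia.
have gap d (i j : 'I_n) : (i + d = j)%N -> (tnth u j + d <= tnth u i)%N.
  elim: d j => [|d IH] j ij.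
    by rewrite addn0 (_ : j = i)//; apply: val_inj; rewrite /= -ij addn0.
  have jn : (i + d < n)%N by have := ltn_ord j; lia.
  have := IH (Ordinal jn) erefl; have := h (Ordinal jn) j; rewrite /=; lia.
exists [tuple (tnth u j - (n.-1 - j))%N | j < n]; last first.
  apply: eq_from_tnth => j; rewrite !tnth_mktuple.
  have n1 : (n.-1 < n)%N by have := ltn_ord j; lia.
  have := gap (n.-1 - j)%N j (Ordinal n1); have := ltn_ord j; rewrite /=; lia.
apply/sorted_tuple_le => i j ij; rewrite !tnth_mktuple.
have := gap (j - i)%N i j; have := ltn_ord j; lia.
Qed.

Lemma Panti_sorted (u : n.-tuple nat) : Panti n u -> Qn n u.
Proof.
move=> /PantiP uP; apply/sorted_tuple_le => i j.
by rewrite leq_eqVlt => /predU1P[/val_inj ->//|/uP/ltnW].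
Qed.

Lemma Panti_inj (u : n.-tuple nat) : Panti n u -> injective (tnth u).
Proof.
move=> /PantiP uP i j uij; apply: val_inj; apply/eqP.
by case: (ltngtP i j) => // /uP; rewrite uij ltnn.
Qed.

Lemma Qn_inj_Panti (u : n.-tuple nat) : Qn n u -> injective (tnth u) -> Panti n u.
Proof.
move=> /sorted_tuple_le uQ u_inj; apply/PantiP => i j ij.
rewrite ltn_neqAle (uQ i j (ltnW ij)) andbT; apply/eqP => /u_inj ji.
by rewrite ji ltnn in ij.
Qed.

End rearrangement.

(** * Symmetrized monomials *)

Section symmetrization.
Variables (R : realType) (n : nat).
Implicit Types (b : bool) (s t : 'S_n) (u v : 'I_n -> nat) (z : 'rV[R[i]]_n).

(** The trivial character of the symmetric group for [b = false], the sign
    character for [b = true]. *)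
Definition eps b s : R[i] := (-1) ^+ (b && odd_perm s).

Lemma epsM b s t : eps b (s * t)%g = eps b s * eps b t.
Proof. by rewrite /eps odd_permM -signr_addb; case: b. Qed.

Lemma epsV b s : eps b s^-1%g = eps b s.
Proof. by rewrite /eps odd_permV. Qed.

Lemma eps_sqr b s : eps b s * eps b s = 1.
Proof. by rewrite /eps -signr_addb addbb. Qed.

Lemma eps_conj b s : (eps b s)^* = eps b s.
Proof. by rewrite /eps rmorph_sign. Qed.

Definition symmetrized b u z : R[i] := \sum_s eps b s * monomial u (col_perm s z).

Lemma monomial_perm u s z : monomial u (col_perm s z) = monomial (u \o s^-1%g) z.
Proof.
rewrite /monomial [RHS](reindex_inj (@perm_inj _ s)).
by apply: eq_bigr => j _; rewrite mxE /= permK.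
Qed.

Lemma symmetrized_perm b u t z :
  symmetrized b u (col_perm t z) = eps b t * symmetrized b u z.
Proof.
rewrite /symmetrized mulr_sumr [RHS](reindex_inj (@mulIg _ t)).
apply: eq_bigr => s _ /=.
by rewrite col_permM epsM mulrA mulrCA eps_sqr mulr1.
Qed.

Lemma symmetrized_comp b u t z :
  symmetrized b (u \o t) z = eps b t * symmetrized b u z.
Proof.
rewrite /symmetrized mulr_sumr [RHS](reindex_inj (@mulgI _ t^-1%g)).
apply: eq_bigr => s _ /=.
rewrite epsM epsV mulrA mulrA eps_sqr mul1r; congr (_ * _).
by rewrite col_permM [RHS]monomial_perm invgK.
Qed.

Lemma elem_sym_perm k s z : elem_sym k (col_perm s z) = elem_sym k z.
Proof.
rewrite /elem_sym [RHS](reindex_inj (imset_inj (@perm_inj _ s))) /=.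
apply: eq_big => [S|S _]; first by rewrite card_imset//; exact: perm_inj.
rewrite big_imset/=; last by move=> i j _ _; exact: perm_inj.
by apply: eq_bigr => j _; rewrite mxE.
Qed.

Lemma elem_sym_monomial k u z : elem_sym k z * monomial u z =
  \sum_(S : {set 'I_n} | #|S| == k) monomial (raise u S) z.
Proof.
rewrite /elem_sym mulr_suml; apply: eq_bigr => S _.
rewrite /monomial [X in X * _]big_mkcond -big_split; apply: eq_bigr => j _ /=.
by rewrite /raise; case: (j \in S); rewrite ?addn1 ?exprS ?addn0 ?mul1r.
Qed.

(** Pieri's rule before any collection of equal terms: being symmetric, [s_k] can
    be moved inside the sum over the group and evaluated at the permuted point. *)
Lemma elem_sym_symmetrized k b u z : elem_sym k z * symmetrized b u z =
  \sum_(S : {set 'I_n} | #|S| == k) symmetrized b (raise u S) z.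
Proof.
rewrite /symmetrized mulr_sumr exchange_big; apply: eq_bigr => s _ /=.
by rewrite mulrCA -(elem_sym_perm k s) elem_sym_monomial mulr_sumr.
Qed.

Lemma alternantE (u : n.-tuple nat) z : alternant u z = symmetrized true (tnth u) z.
Proof.
apply: eq_bigr => s _; congr (_ * _).
by apply: eq_bigr => i _; rewrite !mxE.
Qed.

Lemma alternant_eq0 (u : n.-tuple nat) z : ~ injective (tnth u) -> alternant u z = 0.
Proof.
move=> u_ninj; have /existsNP[i /existsNP[j /not_implyP[uij ij]]] :
  ~ forall i j : 'I_n, tnth u i = tnth u j -> i = j by [].
have {}ij : i != j by exact/eqP.
by apply: (determinant_alternate ij) => k; rewrite !mxE uij.
Qed.

(** The product of the factorials of the multiplicities of the entries of [u]. *)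
Definition stabilizer_card (u : n.-tuple nat) : nat :=
  #|[set s : 'S_n | [forall j, tnth u (s j) == tnth u j]]|.

Lemma stabilizer_card_gt0 (u : n.-tuple nat) : (0 < stabilizer_card u)%N.
Proof.
by apply/card_gt0P; exists 1%g; rewrite inE; apply/forallP => j; rewrite perm1.
Qed.

(** The permutations that turn [u] into a given rearrangement form a coset of the
    stabilizer of [u]. *)
Lemma symmetrized_monomial_sym (u : n.-tuple nat) z :
  symmetrized false (tnth u) z = (stabilizer_card u)%:R * monomial_sym u z.
Proof.
pose F (a : seq nat) : R[i] := \prod_(j < n) z 0 j ^+ nth 0 a j.
pose rear s : seq nat := [tuple tnth u (s j) | j < n].
have -> : symmetrized false (tnth u) z = \sum_(s : 'S_n) F (rear s).
  rewrite /symmetrized (reindex_inj invg_inj); apply: eq_bigr => s _ /=.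
  rewrite mul1r monomial_perm invgK; apply: eq_bigr => j _.
  by rewrite -[nth _ _ _](tnth_nth 0 [tuple tnth u (s j) | j < n]) tnth_mktuple.
have rear_in s : rear s \in permutations u.
  by rewrite mem_permutations; apply/tuple_permP; exists s.
rewrite /monomial_sym -/F mulr_sumr.
transitivity (\sum_(s : 'S_n) \sum_(a <- permutations u | a == rear s) F a).
  apply: eq_bigr => s _; rewrite -big_filter filter_pred1_uniq ?permutations_uniq//.
  by rewrite big_seq1.
rewrite (exchange_big_dep predT)//=; apply: eq_big_seq => a.
rewrite mem_permutations => /tuple_permP[t ->].
rewrite sumr_const mulr_natl; congr (_ *+ _).
rewrite /stabilizer_card -[RHS](card_imset _ (@mulgI _ t)); apply: eq_card => s.
rewrite [LHS]unfold_in; apply/eqP/imsetP => [E|[r]]; last first.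
  rewrite inE => /forallP ru ->; congr val; apply: eq_from_tnth => j.
  by rewrite !tnth_mktuple permM; apply/esym/eqP.
exists (t^-1 * s)%g; last by rewrite mulKVg.
rewrite inE; apply/forallP => j; rewrite permM -{2}(permKV t j); apply/eqP/esym.
have /val_inj/(congr1 (fun w => tnth w (t^-1%g j))) := E.
by rewrite !tnth_mktuple.
Qed.

(** Coordinate permutations act on the symmetrized monomials through the
    character, and on the exponents through rearrangement; so up to a nonzero
    factor only decreasing exponents matter. *)
Lemma symmetrized_rearrangement b u : exists p : 'S_n, forall z,
  symmetrized b u z = eps b p * symmetrized b (tnth (decreasing_rearrangement u)) z.
Proof.
have [p up] := rearrangementP u; exists p => z; rewrite -symmetrized_comp.
by congr symmetrized; apply/funext => j; rewrite up.
Qed.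

End symmetrization.

(** * The isotypic parts of the Bergman space *)

Section isotypic_part.
Variables (R : realType) (n : nat) (l : R).
Hypothesis l0 : 0 < l.
Variable A : fspace R (polydisc R n).
Hypothesis hA : is_rkhs A (@bergman_kernel R n l).
Variable b : bool.

Let hH : is_hilbert A := hA.1.

Definition isotypic (f : polydisc R n -> R[i]) : Prop :=
  forall (s : 'S_n) z, f (perm_pt s^-1%g z) = eps R b s * f z.

Definition isotypic_part : fspace R (polydisc R n) :=
  FSpace [set f | A f /\ isotypic f] (inner A).

Local Notation mon u := (on_polydisc (@monomial R n u)).
Local Notation sym u := (on_polydisc (@symmetrized R n b u)).

Lemma isotypic_hilbert : is_hilbert isotypic_part.
Proof.
apply: (rkhs_subspace_hilbert hA (P := isotypic)) => [s z|a f g fP gP s z|u f uP uf s z].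
- by rewrite mulr0.
- by rewrite fP gP mulrDr mulrCA.
- apply: seqlim_unique (uf _) _; apply: eq_seqlim (seqlimZ (b := eps R b s) (uf z)) => m.
  by rewrite uP.
Qed.

Lemma mul_elem_sym_bounded k : bounded_operator isotypic_part (@mul_elem_sym R n k).
Proof.
have [M _ HM] := elem_sym_multiplier l0 hA k.+1; split.
- move=> f [Af fP]; split; first exact: (HM f Af).1.
  by move=> s z; rewrite /mul_elem_sym fP /= elem_sym_perm mulrCA.
- by move=> a f g _ _; apply/funext => z; rewrite /mul_elem_sym mulrDr mulrCA.
- by exists M => f [Af _]; exact: (HM f Af).2.
Qed.

Lemma symmetrizedE u : sym u = fun z => \sum_s eps R b s * mon (u \o s^-1%g) z.
Proof.
by apply/funext => z; apply: eq_bigr => s _; rewrite monomial_perm.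
Qed.

Lemma symmetrized_in u : isotypic_part (sym u).
Proof.
split.
  by rewrite symmetrizedE; apply: (hilbert_sum hH) => s; exact: (monomial_in l0 hA).
by move=> s z; rewrite /on_polydisc /= symmetrized_perm epsV.
Qed.

Lemma inner_symmetrized_monomial u v : inner A (sym u) (mon v) =
  (\sum_s eps R b s * [forall j, u (s^-1%g j) == v j]%:R) / (norm_const l v)%:C.
Proof.
rewrite symmetrizedE (inner_suml hH); last first.
- exact: (monomial_in l0 hA).
- by move=> s; exact: (monomial_in l0 hA).
by rewrite mulr_suml; apply: eq_bigr => s _; rewrite (inner_monomial l0 hA) mulrA.
Qed.

Lemma inner_symmetrized_eq0 u v :
  (forall s : 'S_n, ~ forall j, u (s j) = v j) -> inner A (sym u) (sym v) = 0.
Proof.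
move=> uv; rewrite [X in inner A _ X]symmetrizedE (inner_sumr hH); last first.
- exact: (symmetrized_in u).1.
- by move=> s; exact: (monomial_in l0 hA).
rewrite big1// => t _; rewrite inner_symmetrized_monomial big1 ?mul0r ?mulr0// => s _.
rewrite (_ : [forall j, _] = false) ?mulr0//; apply/negP => /forallP E.
apply: (uv (t * s^-1)%g) => j; have /eqP := E (t j).
by rewrite /= permK permM.
Qed.

(** Only the stabilizer of [u] contributes to the pairing with the monomial [u];
    it contributes with positive signs, since it is trivial in the alternating
    case. *)
Lemma symmetrized_neq0 u : (b -> injective u) -> inner A (sym u) (mon u) != 0.
Proof.
move=> u_inj; rewrite inner_symmetrized_monomial mulf_neq0//; last first.
  by rewrite invr_eq0 fmorph_eq0 gt_eqF// norm_const_gt0.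
rewrite (eq_bigr (fun s : 'S_n => [forall j, u (s^-1%g j) == u j]%:R)) => [|s _]; last first.
  have [/forallP us|_] := boolP [forall j, u (s^-1%g j) == u j]; last by rewrite mulr0.
  rewrite mulr1 /eps; case: b u_inj => // /(_ isT) u_inj.
  rewrite (_ : s = 1%g) ?odd_perm1//; apply/permP => j; rewrite perm1.
  by apply: u_inj; rewrite -(eqP (us (s j))) permK.
rewrite -natr_sum pnatr_eq0 (bigD1 1%g)//= (_ : [forall j, _])//.
by apply/forallP => j; rewrite invg1 perm1.
Qed.

Lemma kernel_truncation_perm (s : 'S_n) (w : polydisc R n) N z :
  kernel_truncation l (perm_pt s^-1%g w) N z = kernel_truncation l w N (perm_pt s z).
Proof.
rewrite !kernel_truncationE [RHS](reindex_inj (@perm_inj _ s^-1%g)).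
by apply: eq_bigr => j _; rewrite /= !mxE permKV.
Qed.

Lemma card_perm_neq0 : #|{: 'S_n}|%:R != 0 :> R[i].
Proof. by rewrite pnatr_eq0 -lt0n; apply/card_gt0P; exists 1%g. Qed.

(** Averaging the reproducing formula over the group expresses [f w] as a limit
    of pairings of [f] with symmetrized monomials. *)
Lemma isotypic_complete f : isotypic_part f ->
  (forall u, inner A f (sym u) = 0) -> f = fun=> 0.
Proof.
move=> [Af fP] f0; apply/funext => w; apply/eqP.
have lim_s s := seqlimZ (b := eps R b s) (kernel_truncation_lim l0 hA (w := perm_pt s^-1%g w) Af).
have := seqlim_sum lim_s.
under eq_bigr do rewrite fP rmorphM/= eps_conj mulrA eps_sqr mul1r.
rewrite sumr_const -mulr_natl => h.
have : #|{: 'S_n}|%:R * (f w)^* = 0.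
  apply: seqlim_unique h _; apply: eq_seqlim (@seqlim_cst _ 0) => N.
  rewrite -(inner_suml hH); last exact: Af.
    rewrite (_ : (fun z => _) = fun z => \sum_(U : {ffun 'I_n -> 'I_N})
       (\prod_j ((nbc l (U j))%:C * ((val w) 0 j)^* ^+ U j)) * sym (fun j => U j : nat) z).
      rewrite (inner_suml hH); last exact: Af.
        rewrite big1// => U _; rewrite (innerC hH Af (symmetrized_in _).1).
        by rewrite f0 conjC0 mulr0.
      by move=> U; exact: (symmetrized_in _).1.
    apply/funext => z.
    under eq_bigr do rewrite kernel_truncation_perm mulr_sumr.
    rewrite exchange_big; apply: eq_bigr => U _ /=.
    rewrite /on_polydisc /symmetrized mulr_sumr; apply: eq_bigr => s _.
    by rewrite mulrCA.
  by move=> s; exact: (kernel_truncation_in l0 hA).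
by move/eqP; rewrite mulf_eq0 (negbTE card_perm_neq0)/= conjC_eq0.
Qed.

(** Here [base u] is the basis vector attached to a vertex [u], proportional to the
    symmetrized monomial, and [c] gives the coefficients of Pieri's rule. *)
Section model.
Variables (W : set (n.-tuple nat)) (base : n.-tuple nat -> 'rV[R[i]]_n -> R[i])
  (kappa : n.-tuple nat -> nat).
Hypothesis W_sorted : forall u, W u -> Qn n u.
Hypothesis W_inj : forall u, W u -> b -> injective (tnth u).
Hypothesis kappa_gt0 : forall u, (0 < kappa u)%N.
Hypothesis symmetrized_base : forall u (z : 'rV[R[i]]_n), W u ->
  symmetrized b (tnth u) z = (kappa u)%:R * base u z.
Hypothesis symmetrized_eq0 : forall u (z : 'rV[R[i]]_n), Qn n u -> ~ W u -> symmetrized b (tnth u) z = 0.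
Variable c : 'I_n -> W -> W -> R.
Let E (k : 'I_n) (u v : W) : Prop := Iset k.+1 (val u) (val v).
Hypothesis pieri : forall (k : 'I_n) (u : W) (z : 'rV[R[i]]_n),
  elem_sym k.+1 z * base (val u) z = \sum_(v \in Chi (E k) u) (c k u v)%:C * base (val v) z.

Let e (u : W) : polydisc R n -> R[i] := on_polydisc (base (val u)).

Let kappa_neq0 u : (kappa u)%:R != 0 :> R[i].
Proof. by rewrite pnatr_eq0 -lt0n. Qed.

Let W_val (u : W) : W (val u).
Proof. exact: set_mem (valP u). Qed.

Let sym_e (u : W) : sym (tnth (val u)) = fun z => (kappa (val u))%:R * e u z.
Proof. by apply/funext => z; rewrite /on_polydisc symmetrized_base. Qed.

Let eE (u : W) : e u = fun z => (kappa (val u))%:R^-1 * sym (tnth (val u)) z.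
Proof. by apply/funext => z; rewrite sym_e mulKf. Qed.

Let He (u : W) : isotypic_part (e u).
Proof. by rewrite eE; apply: (hilbertZ isotypic_hilbert); exact: symmetrized_in. Qed.

Let orthogonal_e (u v : W) : u != v -> inner isotypic_part (e u) (e v) = 0.
Proof.
move=> uv; have [Su Sv] := (symmetrized_in (tnth (val u)), symmetrized_in (tnth (val v))).
rewrite (eE u) (eE v) (innerZl isotypic_hilbert)//; last first.
  by apply: (hilbertZ isotypic_hilbert).
rewrite (innerZr isotypic_hilbert)// [inner _ _ _]inner_symmetrized_eq0 ?mulr0// => s E'.
move/eqP: uv; apply; apply: val_inj; apply/esym.
by apply: (@Qn_perm_inj _ _ _ s) => [||j]; rewrite ?E'//; exact: W_sorted.
Qed.

Let e_neq0 (u : W) : hnorm isotypic_part (e u) != 0.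
Proof.
apply/eqP => /(hnorm_eq0 isotypic_hilbert (He u)) e0.
have := symmetrized_neq0 (W_inj (W_val u)).
have -> : sym (tnth (val u)) = fun=> 0 by rewrite sym_e e0; apply/funext => z; rewrite mulr0.
by rewrite (inner0l hH) ?eqxx//; exact: (monomial_in l0 hA).
Qed.

Let complete_e f : isotypic_part f ->
  (forall u : W, inner isotypic_part f (e u) = 0) -> f = fun=> 0.
Proof.
move=> Pf f0; apply: isotypic_complete => // u.
have [p up] := symmetrized_rearrangement R b u.
set v := decreasing_rearrangement u in up.
have -> : sym u = fun z => eps R b p * sym (tnth v) z.
  by apply/funext => z; rewrite /on_polydisc up.
rewrite (innerZr hH); [|exact: (symmetrized_in _).1|exact: Pf.1].
have [Wv|nWv] := pselect (W v); last first.
  rewrite (_ : sym (tnth v) = fun=> 0) ?(innerC hH (hilbert0 hH) Pf.1) ?(inner0l hH Pf.1) ?conjC0 ?mulr0//.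
  by apply/funext => z; apply: symmetrized_eq0 => //; exact: rearrangement_sorted.
pose v' : W := exist _ v (mem_set Wv).
have := sym_e v'; rewrite /= => ->.
rewrite (innerZr hH); [|exact: (He v').1|exact: Pf.1].
by rewrite [inner _ _ _]f0 !mulr0.
Qed.

Lemma isotypic_model : exists L : 'I_n -> (W -> R[i]) -> (W -> R[i]),
  (forall k, is_weighted_shift (E k)
     (fun u v => (c k u v * (norm_on A (base (val v)) / norm_on A (base (val u))))%:C) (L k)) /\
  unitarily_equivalent isotypic_part (ell2 R W) (@mul_elem_sym R n) L.
Proof.
apply: (weighted_shift_model isotypic_hilbert He orthogonal_e e_neq0 complete_e
  mul_elem_sym_bounded (E := E) (c := c)) => [k u|k u z].
- exact: Chi_box_finite.
- exact: pieri.
Qed.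

End model.
End isotypic_part.

(** * Pieri's rules and the theorem *)

Lemma fsbig_fibers (K : pzRingType) (I : finType) (V : choiceType) (P : pred I)
    (phi : I -> V) (C : set V) (G : I -> K) (B : V -> K) :
  C = phi @` [set i | P i] ->
  \sum_(i | P i) G i * B (phi i) =
  \sum_(v \in C) (\sum_(i | P i && (phi i == v)) G i) * B v.
Proof.
move=> CE; have finC : finite_set C.
  by rewrite CE; apply: finite_image; exact: finite_finset.
rewrite fsbig_finite//=; under [RHS]eq_bigr do rewrite mulr_suml.
rewrite (exchange_big_dep P)//=; last by move=> v i _ /andP[].
apply: eq_bigr => i Pi; rewrite -big_filter.
rewrite (eq_filter (a2 := pred1 (phi i))); last by move=> v; rewrite Pi/= eq_sym.
rewrite filter_pred1_uniq ?big_seq1 ?fset_uniq//.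
by rewrite in_fset_set// inE CE; exists i.
Qed.

Section pieri_rules.
Variables (R : realType) (n : nat).

Definition rearranged_vertex (u : 'I_n -> nat) : Psym n :=
  exist _ (decreasing_rearrangement u) (mem_set (rearrangement_sorted u)).

Lemma Chi_Gsym (k : 'I_n) (u : Psym n) : Chi (Gsym k) u =
  (fun S => rearranged_vertex (raise (tnth (val u)) S)) @`
    [set S : {set 'I_n} | #|S| == k.+1].
Proof.
have uQ : Qn n (val u) := set_mem (valP u).
apply/seteqP; split=> [v uv|_ [S /eqP Sk <-]]; last exact: raise_rearrangement.
exists (raised_set (val u) (val v)); last exact/val_inj/(Iset_rearrangement uv).
by have [_ cardS _] := (IsetP _ _ _).1 uv; exact/eqP.
Qed.

(** Expanding [s_k m_u] over all raises of [u], the raises that rearrange to [v]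
    each contribute the ratio of the orders of the stabilizers of [v] and [u]. *)
Definition pieri_coeff (k : 'I_n) (u v : Psym n) : rat :=
  \sum_(S : {set 'I_n} | (#|S| == k.+1) &&
      (rearranged_vertex (raise (tnth (val u)) S) == v))
    (stabilizer_card (val v))%:R / (stabilizer_card (val u))%:R.

Lemma pieri_coeff_gt0 k u v : Gsym k u v -> 0 < pieri_coeff k u v.
Proof.
move=> uv; have pos (w : Psym n) : 0 < (stabilizer_card (val w))%:R :> rat.
  by rewrite ltr0n stabilizer_card_gt0.
rewrite /pieri_coeff (bigD1 (raised_set (val u) (val v)))/=; last first.
  have [_ -> _] := (IsetP _ _ _).1 uv; rewrite eqxx/=; apply/eqP/val_inj.
  exact: Iset_rearrangement uv.
apply: ltr_pwDl; first by apply: divr_gt0; exact: pos.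
by apply: sumr_ge0 => S _; apply: divr_ge0; exact/ltW/pos.
Qed.

Lemma pieri_monomial_sym (k : 'I_n) (u : Psym n) (z : 'rV[R[i]]_n) :
  elem_sym k.+1 z * monomial_sym (val u) z =
  \sum_(v \in Chi (Gsym k) u) ratr (pieri_coeff k u v) * monomial_sym (val v) z.
Proof.
have k0 (w : n.-tuple nat) : (stabilizer_card w)%:R != 0 :> R[i].
  by rewrite pnatr_eq0 -lt0n stabilizer_card_gt0.
have expand : elem_sym k.+1 z * monomial_sym (val u) z =
    \sum_(S : {set 'I_n} | #|S| == k.+1)
       ((stabilizer_card (val (rearranged_vertex (raise (tnth (val u)) S))))%:R /
        (stabilizer_card (val u))%:R) *
       monomial_sym (val (rearranged_vertex (raise (tnth (val u)) S))) z.
  apply: (mulfI (k0 (val u))).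
  rewrite mulrCA -symmetrized_monomial_sym elem_sym_symmetrized mulr_sumr.
  apply: eq_bigr => S _; set w := raise _ S.
  rewrite mulrA mulrCA divff// mulr1.
  have [p ->] := symmetrized_rearrangement R false w.
  by rewrite mul1r symmetrized_monomial_sym.
rewrite expand.
rewrite (fsbig_fibers (phi := fun S => rearranged_vertex (raise (tnth (val u)) S))
  _ (fun v : Psym n => monomial_sym (val v) z) (Chi_Gsym k u)).
apply: eq_fsbigr => v _; congr (_ * _).
rewrite /pieri_coeff rmorph_sum; apply: eq_bigr => S /andP[_ /eqP <-].
by rewrite fmorph_div !rmorph_nat.
Qed.

Lemma raise_sorted (u : n.-tuple nat) (S : {set 'I_n}) : Panti n u ->
  Qn n (mktuple (raise (tnth u) S)).
Proof.
move=> /PantiP uP; apply/sorted_tuple_le => i j; rewrite leq_eqVlt => /predU1P[/val_inj ->//|].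
move=> /uP uij; rewrite !tnth_mktuple /raise.
by case: (i \in S); case: (j \in S); lia.
Qed.

(** Raises that are not strictly decreasing are not vertices and get the dummy
    value [u]; they are excluded wherever this function is applied. *)
Definition raised_vertex (u : Panti n) (S : {set 'I_n}) : Panti n :=
  if pselect (Panti n (mktuple (raise (tnth (val u)) S))) is left h
  then exist _ (mktuple (raise (tnth (val u)) S)) (mem_set h) else u.

Let strict_raise (k : 'I_n) (u : Panti n) : pred {set 'I_n} :=
  fun S => (#|S| == k.+1) && `[< Panti n (mktuple (raise (tnth (val u)) S)) >].

Lemma val_raised_vertex (u : Panti n) S : Panti n (mktuple (raise (tnth (val u)) S)) ->
  val (raised_vertex u S) = mktuple (raise (tnth (val u)) S).
Proof. by rewrite /raised_vertex; case: pselect. Qed.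

Lemma Chi_Ganti (k : 'I_n) (u : Panti n) :
  Chi (Ganti k) u = raised_vertex u @` [set S | strict_raise k u S].
Proof.
apply/seteqP; split=> [v uv|_ [S /andP[/eqP Sk /asboolP Sv] <-]]; last first.
  rewrite /Chi/= /Ganti val_raised_vertex//; apply/IsetP.
  have rE : tnth (mktuple (raise (tnth (val u)) S)) =1 raise (tnth (val u)) S.
    by move=> j; rewrite tnth_mktuple.
  by rewrite (raised_set_raise rE); split=> //; exact: Panti_sorted.
have [_ cardS vE] := (IsetP _ _ _).1 uv; set S := raised_set _ _ in cardS vE.
have SE : mktuple (raise (tnth (val u)) S) = val v.
  by apply: eq_from_tnth => j; rewrite tnth_mktuple vE.
have Sv : Panti n (mktuple (raise (tnth (val u)) S)) by rewrite SE; exact: set_mem (valP v).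
exists S; last by apply: val_inj; rewrite val_raised_vertex.
by apply/andP; split; [rewrite cardS|exact/asboolP].
Qed.

(** A raise of a strictly decreasing exponent is decreasing; when it is not
    strictly so its alternant has two equal rows. The remaining raises are
    distinct vertices, so that every coefficient is [1]. *)
Lemma pieri_alternant (k : 'I_n) (u : Panti n) (z : 'rV[R[i]]_n) :
  elem_sym k.+1 z * alternant (val u) z =
  \sum_(v \in Chi (Ganti k) u) alternant (val v) z.
Proof.
have uP : Panti n (val u) := set_mem (valP u).
have expand : elem_sym k.+1 z * alternant (val u) z =
    \sum_(S | strict_raise k u S) 1 * alternant (val (raised_vertex u S)) z.
  rewrite alternantE elem_sym_symmetrized (bigID (fun S => `[< Panti n (mktuple (raise (tnth (val u)) S)) >]))/=.
  have rE (S : {set 'I_n}) : raise (tnth (val u)) S = tnth (mktuple (raise (tnth (val u)) S)).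
    by apply/funext => j; rewrite tnth_mktuple.
  rewrite [X in _ + X]big1 ?addr0 => [|S /andP[_ /asboolPn nP]].
    apply: eq_bigr => S /andP[_ /asboolP SP].
    by rewrite mul1r val_raised_vertex// alternantE -rE.
  rewrite rE -alternantE; apply: alternant_eq0 => inj; apply: nP.
  exact: Qn_inj_Panti (raise_sorted S uP) inj.
rewrite expand (fsbig_fibers _ (fun v : Panti n => alternant (val v) z) (Chi_Ganti k u)).
apply: eq_fsbigr => v; rewrite inE Chi_Ganti => -[S SP <-].
rewrite (big_pred1 S) ?mul1r// => S'; apply/andP/eqP => [[S'P /eqP SS']|->]; last first.
  by split=> //; exact: eqxx.
have [_ /asboolP h] := andP SP; have [_ /asboolP h'] := andP S'P.
have := congr1 val SS'; rewrite !val_raised_vertex// => E.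
have rE (T : {set 'I_n}) : tnth (mktuple (raise (tnth (val u)) T)) =1 raise (tnth (val u)) T.
  by move=> j; rewrite tnth_mktuple.
by rewrite -(raised_set_raise (rE S')) E (raised_set_raise (rE S)).
Qed.

End pieri_rules.

Lemma sym_partE (R : realType) (n : nat) (A : fspace R (polydisc R n)) :
  sym_part A = isotypic_part A false.
Proof.
congr FSpace; apply/funext => f; apply/propext; split=> -[Af fP]; split=> // s z.
  by rewrite mul1r fP.
by rewrite fP mul1r.
Qed.

Theorem theorem4p6 (R : realType) (n : nat) (lambda : R)
    (n_gt1 : (1 < n)%N) (lambda_gt0 : 0 < lambda)
    (A : fspace R (polydisc R n)) (A_bergman : is_weighted_bergman lambda A) :
  (exists (c : 'I_n -> Psym n -> Psym n -> rat) (r : 'I_n -> nat)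
          (L : 'I_n -> (Psym n -> R[i]) -> (Psym n -> R[i])),
     [/\ is_sym_coeff R c,
         forall k, generalized_directed_semi_tree (Gsym k) /\
                   least_common_children_bound (Gsym k) (r k),
         forall k, is_weighted_shift (Gsym k) (sym_weight A c k) (L k)
       & unitarily_equivalent (sym_part A) (ell2 R (Psym n)) (@mul_elem_sym R n) L])
  /\
  (exists (m : 'I_n -> nat)
          (L : 'I_n -> (Panti n -> R[i]) -> (Panti n -> R[i])),
     [/\ forall k, generalized_directed_semi_tree (Ganti k) /\
                   least_common_children_bound (Ganti k) (m k),
         forall k, is_weighted_shift (Ganti k) (anti_weight A) (L k)
       & unitarily_equivalent (anti_part A) (ell2 R (Panti n)) (@mul_elem_sym R n) L]).
Proof.
have hA := A_bergman.1; split.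
- have [||u z uQ nuQ|k u z|L [shiftL equivL]] := @isotypic_model _ _ _ lambda_gt0 _ hA false
    (Psym n) (@monomial_sym R n) (@stabilizer_card n) _ _ (@stabilizer_card_gt0 n)
    (fun u z _ => symmetrized_monomial_sym u z) _ (fun k u v => ratr (pieri_coeff k u v)).
  + by [].
  + by [].
  + by case: (nuQ uQ).
  + rewrite pieri_monomial_sym; apply: eq_fsbigr => v _.
    by rewrite [in RHS](fmorph_rat (real_complex R)).
  have /choice[r rP] : forall k : 'I_n, exists m, least_common_children_bound (Gsym k) m.
    by move=> k; exact: box_graph_least_bound.
  exists (@pieri_coeff n), r, L; split.
  + by split=> [k u v|k u z]; [exact: pieri_coeff_gt0|exact: pieri_monomial_sym].
  + by move=> k; split; [exact: box_graph_semi_tree|exact: rP].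
  + exact: shiftL.
  + by rewrite sym_partE.
- have [||u z uP|u z uQ nuP|k u z|L [shiftL equivL]] := @isotypic_model _ _ _ lambda_gt0 _ hA true
    (Panti n) (@alternant R n) (fun=> 1%N) _ _ (fun=> isT) _ _ (fun _ _ _ => 1).
  + exact: Panti_sorted.
  + by move=> u uP _; exact: Panti_inj.
  + by rewrite mul1r alternantE.
  + rewrite -alternantE; apply: alternant_eq0 => inj; apply: nuP.
    exact: Qn_inj_Panti.
  + rewrite pieri_alternant; apply: eq_fsbigr => v _.
    by rewrite mul1r.
  have /choice[m mP] : forall k : 'I_n, exists m, least_common_children_bound (Ganti k) m.
    by move=> k; exact: box_graph_least_bound.
  exists m, L; split.
  + by move=> k; split; [exact: box_graph_semi_tree|exact: mP].
  + move=> k; have := shiftL k; congr (is_weighted_shift _ _ _).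
    by apply/funext => u; apply/funext => v; rewrite mul1r.
  + exact: equivL.
Qed.
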